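(* Let $G$ be a $4$-connected simple graph with an odd number of vertices. Then $\chi'_o(G)\le 3$, i.e., $G$ is odd $3$-edge-colorable.
   Context: All graphs are finite and simple. For a graph $G$, a subgraph $H$ is an odd subgraph if every vertex of $H$ has odd degree in $H$. $G$ is odd $k$-edge-colorable if there is a map $c:E(G)\to\{1,\dots,k\}$ such that for each $i$ with $c^{-1}(i)\neq\emptyset$, the subgraph formed by the edge set $c^{-1}(i)$ (together with the endpoints of those edges) is an odd subgraph of $G$. The odd chromatic index $\chi'_o(G)$ is the minimum $k$ such that $G$ is odd $k$-edge-colorable. *)

(* Defs.v *)
From HB Require Import structures.
From mathcomp Require Import all_boot.

Set Implicit Arguments.
Unset Strict Implicit.
Unset Printing Implicit Defensive.

Record sgraph := SGraph {
  vertex :> finType;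
  adj : rel vertex;
  adj_sym : symmetric adj;
  adj_irr : irreflexive adj }.

Definition edges (G : sgraph) : {set {set G}} :=
  [set [set x; y] | x in G, y in G & adj x y].

Definition edge (G : sgraph) : finType := {f : {set G} | f \in edges G}.

(* [connect] is reflexive, so the empty set counts as connected; this is
   harmless in [k_connected], where the remaining set is never empty. *)
Definition connected_in (G : sgraph) (A : {set G}) : bool :=
  [forall x in A, forall y in A,
     connect [rel u v | [&& u \in A, v \in A & adj u v]] x y].

Definition k_connected (k : nat) (G : sgraph) : bool :=
  (k < #|G|) && [forall S : {set G}, (#|S| < k) ==> connected_in (~: S)].

Definition degree (G : sgraph) (F : {set {set G}}) (x : G) : nat :=
  #|[set f in F | x \in f]|.

Definition odd_graph (G : sgraph) (V : {set G}) (F : {set {set G}}) : bool :=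
  [forall x in V, odd (degree F x)].

Definition color_class (G : sgraph) (k : nat) (c : {ffun edge G -> 'I_k})
    (i : 'I_k) : {set {set G}} :=
  [set val f | f : edge G & c f == i].

(* [cover F] is the set of endpoints of the edges in [F]. *)
Definition odd_edge_coloring (G : sgraph) (k : nat)
    (c : {ffun edge G -> 'I_k}) : bool :=
  [forall i : 'I_k, (color_class c i != set0) ==>
     odd_graph (cover (color_class c i)) (color_class c i)].

Definition odd_edge_colorable (G : sgraph) (k : nat) : bool :=
  [exists c : {ffun edge G -> 'I_k}, odd_edge_coloring c].

(* A single edge is an odd subgraph, so giving all edges distinct colors is an
   odd edge-coloring and the minimum below is over a nonempty set. *)
Lemma odd_edge_colorable_ex (G : sgraph) : exists k, odd_edge_colorable G k.
Proof.
exists #|edge G|; apply/existsP; exists [ffun f => enum_rank f].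
apply/forallP => i; apply/implyP => _; apply/forallP => x; apply/implyP.
have -> : color_class [ffun f : edge G => enum_rank f] i
          = [set val (enum_val i)].
  apply/setP => g; rewrite inE; apply/imsetP/eqP => [[f]|->].
    by rewrite inE ffunE => /eqP <- ->; rewrite enum_rankK.
  by exists (enum_val i); rewrite // inE ffunE enum_valK.
rewrite /cover big_set1 /degree => xf.
suff -> : [set f in [set val (enum_val i)] | x \in f]
          = [set val (enum_val i)] by rewrite cards1.
by apply/setP => g; rewrite !inE; case: eqP => // ->.
Qed.

Definition odd_chromatic_index (G : sgraph) : nat :=
  ex_minn (odd_edge_colorable_ex G).

Lemma odd_edge_colorable_widen (G : sgraph) (k m : nat) :
  k <= m -> odd_edge_colorable G k -> odd_edge_colorable G m.
Proof.
move=> le_km /existsP[c /forallP c_odd]; apply/existsP.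
exists [ffun f => widen_ord le_km (c f)].
apply/forallP => i; apply/implyP => /set0Pn[g /imsetP[f]].
rewrite inE ffunE => /eqP <- _.
have -> : color_class [ffun f => widen_ord le_km (c f)] (widen_ord le_km (c f))
          = color_class c (c f).
  by apply/setP => g'; apply/imsetP/imsetP => -[h];
    rewrite inE ?ffunE => hE ->; exists h; rewrite // inE ?ffunE.
apply: (implyP (c_odd (c f))); apply/set0Pn; exists (val f).
by apply: imset_f; rewrite inE.
Qed.

Lemma odd_chromatic_index_le (G : sgraph) (k : nat) :
  (odd_chromatic_index G <= k) = odd_edge_colorable G k.
Proof.
rewrite /odd_chromatic_index; case: ex_minnP => m Gm m_min.
by apply/idP/idP => [le_mk|/m_min //]; apply: odd_edge_colorable_widen Gm.
Qed.

(* Main.v *)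
Require Import Defs.
From mathcomp Require Import all_boot.

(* Split the edges as [edges G :\: R], [J], [R :\: J].  The number of vertices of
   even degree is odd; let [v] be one of them and take [R = F :|: star v], where
   [F] is an edge set of [G - v] with odd vertices [nbr v] (+) [evenv G :\ v], so
   that [edges G :\: R] is odd at every vertex but [v].

   If there is another vertex of even degree, partition [G - v] into connected
   sets [C] and [K] such that [C] contains exactly one neighbour of [v] and
   exactly one vertex of even degree, and take [F] a forest inside [C] and [K].
   Then [R] has a 2-colouring that is correct except perhaps at [v], and
   exchanging the two colours on [C] corrects [v].

   If [v] is the only vertex of even degree, then [R] is even.  Some vertex
   [u] not adjacent to [v] has a neighbour [y] adjacent to [v] (unless [v] is
   adjacent to all vertices, an easy case), and adding to [F] some of the cycles
   of a theta graph with branch vertices [u] and [y] one makes the number of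
   non-isolated vertices of [R] even; they form one component of [R], which
   therefore contains a spanning odd subgraph [J], and [R :\: J] is odd too. *)

Set Implicit Arguments.
Unset Strict Implicit.
Unset Printing Implicit Defensive.

(** * Joins *)

Definition symd (T : finType) (A B : {set T}) : {set T} :=
  [set x | (x \in A) (+) (x \in B)].

Lemma in_symd (T : finType) (A B : {set T}) x :
  (x \in symd A B) = (x \in A) (+) (x \in B).
Proof. by rewrite inE. Qed.

Lemma symdAC (T : finType) (A B C : {set T}) :
  symd (symd A B) C = symd (symd A C) B.
Proof. by apply/setP => x; rewrite !in_symd -!addbA (addbC (x \in B)). Qed.

Lemma odd_card_symd (T : finType) (A B : {set T}) :
  odd #|symd A B| = odd #|A| (+) odd #|B|.
Proof.
have -> : symd A B = (A :\: B) :|: (B :\: A).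
  by apply/setP => x; rewrite !inE; do 2!case: (_ \in _).
have dAB : [disjoint A :\: B & B :\: A].
  rewrite -setI_eq0; apply/eqP/setP => x; rewrite !inE.
  by do 2!case: (_ \in _).
rewrite cardsU disjoint_setI0 // cards0 subn0 oddD.
rewrite -(cardsID B A) -(cardsID A B) !oddD (setIC B A).
by do 3!case: (odd _).
Qed.

Lemma subset_symd (T : finType) (A B C : {set T}) :
  A \subset C -> B \subset C -> symd A B \subset C.
Proof.
move=> /subsetP AC /subsetP BC; apply/subsetP => x; rewrite in_symd.
by case: (boolP (x \in A)) => [/AC //|_ /= /BC].
Qed.

Lemma odd_sum (T : finType) (f : T -> nat) :
  odd (\sum_x f x) = odd #|[set x | odd (f x)]|.
Proof.
rewrite -sum1_card [in RHS]big_mkcond /=.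
rewrite !(big_morph odd oddD (erefl _)).
by apply: eq_bigr => x _; rewrite inE; case: (odd _).
Qed.

(** * Degrees and parities of edge sets *)

Definition nbr (G : sgraph) (v : G) : {set G} := [set x | adj v x].

Definition star (G : sgraph) (v : G) : {set {set G}} :=
  [set f in edges G | v \in f].

Definition edges_in (G : sgraph) (A : {set G}) : {set {set G}} :=
  [set f in edges G | f \subset A].

(** The boundary map over the two-element field: [oddv_symd] is its linearity, [oddv F = set0] says
    that [F] is an even subgraph, and [oddv F = T] that [F] is a [T]-join. *)
Definition oddv (G : sgraph) (F : {set {set G}}) : {set G} :=
  [set x | odd (degree F x)].

Definition evenv (G : sgraph) : {set G} := ~: oddv (edges G).

Lemma adj_neq (G : sgraph) (x y : G) : adj x y -> x != y.
Proof. by case: eqP => // ->; rewrite adj_irr. Qed.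

Lemma edgesP (G : sgraph) (f : {set G}) :
  reflect (exists x y, adj x y /\ f = [set x; y]) (f \in edges G).
Proof.
apply: (iffP imset2P) => [[x y _] | [x [y [xy ->]]]].
  by rewrite inE => /andP[_ xy] ->; exists x, y.
by exists x y; rewrite ?inE.
Qed.

Lemma edgeP (G : sgraph) (f : {set G}) (x : G) : f \in edges G -> x \in f ->
  exists2 y, adj x y & f = [set x; y].
Proof.
case/edgesP => a [b [ab ->]]; rewrite !inE => /orP[]/eqP->; first by exists b.
by exists a; rewrite 1?adj_sym // setUC.
Qed.

Lemma set2_inj (G : sgraph) (x a b : G) : [set x; a] = [set x; b] -> a = b.
Proof.
move=> /setP e; have:= e a; have:= e b; rewrite !inE !eqxx !orbT.
case: (eqVneq b x) => [->|_]; last by rewrite /= => /eqP ->.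
by move=> _ /esym; rewrite orbb => /eqP.
Qed.

Lemma mem_edges (G : sgraph) (x y : G) : ([set x; y] \in edges G) = adj x y.
Proof.
apply/idP/idP => [xy|xy]; last by apply/edgesP; exists x, y.
by have [z xz /set2_inj ->] := edgeP xy (set21 x y).
Qed.

Lemma card_edge (G : sgraph) (f : {set G}) : f \in edges G -> #|f| = 2.
Proof. by case/edgesP => x [y [/adj_neq xy ->]]; rewrite cards2 xy. Qed.

Lemma degree_gt0 (G : sgraph) (F : {set {set G}}) (x : G) :
  (0 < degree F x) = (x \in cover F).
Proof.
rewrite card_gt0; apply/set0Pn/bigcupP => [[f]|[f fF xf]].
  by rewrite inE => /andP[]; exists f.
by exists f; rewrite inE fF.
Qed.

Lemma degree_eq0 (G : sgraph) (F : {set {set G}}) (x : G) :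
  (degree F x == 0) = (x \notin cover F).
Proof. by rewrite -degree_gt0 lt0n negbK. Qed.

Lemma notin_coverP (G : sgraph) (F : {set {set G}}) (x : G) :
  reflect (forall f, f \in F -> x \notin f) (x \notin cover F).
Proof.
apply: (iffP idP) => [xF f fF|xF]; last first.
  by apply/bigcupP => -[f /xF /negPf ->].
by apply: contra xF => xf; apply/bigcupP; exists f.
Qed.

Lemma degreeD (G : sgraph) (F J : {set {set G}}) (x : G) :
  J \subset F -> degree F x = degree J x + degree (F :\: J) x.
Proof.
move=> JF; rewrite /degree -(cardsID J); congr (_ + _).
  apply: eq_card => f; rewrite !inE andbAC; congr (_ && _).
  by case: (boolP (f \in J)) => [/(subsetP JF) ->|]; rewrite ?andbF.
by apply: eq_card => f; rewrite !inE andbA.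
Qed.

Lemma odd_degree_symd (G : sgraph) (E F : {set {set G}}) (x : G) :
  odd (degree (symd E F) x) = odd (degree E x) (+) odd (degree F x).
Proof.
rewrite /degree -odd_card_symd; congr odd; apply: eq_card => f.
by rewrite !inE; case: (x \in f); rewrite ?andbF ?andbT.
Qed.

Lemma oddv_symd (G : sgraph) (E F : {set {set G}}) :
  oddv (symd E F) = symd (oddv E) (oddv F).
Proof. by apply/setP => x; rewrite !inE odd_degree_symd. Qed.

Lemma oddv_sub_cover (G : sgraph) (F : {set {set G}}) (x : G) :
  x \in oddv F -> x \in cover F.
Proof. by rewrite inE -degree_gt0; case: (degree F x). Qed.

Lemma oddv0 (G : sgraph) : oddv (set0 : {set {set G}}) = set0.
Proof.
apply/setP => x; rewrite !inE.
have /eqP -> // : degree (set0 : {set {set G}}) x == 0.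
by rewrite degree_eq0; apply/notin_coverP => f; rewrite inE.
Qed.

Lemma sum_degree (G : sgraph) (F : {set {set G}}) :
  F \subset edges G -> \sum_x degree F x = #|F|.*2.
Proof.
move=> /subsetP FE.
transitivity (\sum_(f in F) \sum_x (x \in f : nat)).
  rewrite exchange_big /=; apply: eq_bigr => x _.
  rewrite /degree -sum1_card big_mkcond [RHS]big_mkcond /=.
  by apply: eq_bigr => f _; rewrite inE; case: (f \in F); case: (x \in f).
rewrite -mul2n mulnC -sum_nat_const; apply: eq_bigr => f /FE/card_edge <-.
by rewrite -sum1_card [RHS]big_mkcond; apply: eq_bigr => x _; case: (_ \in _).
Qed.

Lemma handshake (G : sgraph) (F : {set {set G}}) :
  F \subset edges G -> ~~ odd #|oddv F|.
Proof. by move=> FE; rewrite -odd_sum sum_degree // odd_double. Qed.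

Lemma degree_star (G : sgraph) (v x : G) :
  x != v -> degree (star v) x = adj v x.
Proof.
move=> xv; rewrite /degree.
have fE f : f \in [set f in star v | x \in f] -> adj v x /\ f = [set v; x].
  rewrite !inE => /andP[/andP[fE vf] xf]; have [y vy fy] := edgeP fE vf.
  by move: xf; rewrite fy !inE (negPf xv) /= => /eqP ->.
case: (boolP (adj v x)) => vx.
  rewrite (_ : [set f in _ | _] = [set [set v; x]]) ?cards1 //.
  apply/setP => f; rewrite in_set1; apply/idP/eqP => [/fE[]//|->].
  by rewrite !inE mem_edges vx !eqxx !orbT.
by apply: eq_card0 => f; apply/negbTE; apply: contra vx => /fE[].
Qed.

Lemma degree_star_id (G : sgraph) (v : G) : degree (star v) v = degree (edges G) v.
Proof. by apply: eq_card => f; rewrite !inE -andbA andbb. Qed.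

Lemma degree_edges (G : sgraph) (v : G) : degree (edges G) v = #|nbr v|.
Proof.
rewrite -(card_imset _ (@set2_inj G v)); apply: eq_card => f.
rewrite inE; apply/andP/imsetP => [[fE /(edgeP fE)[y vy ->]]|[y]].
  by exists y; rewrite ?inE.
by rewrite inE => vy ->; rewrite mem_edges !inE eqxx.
Qed.

Lemma edges_in_sub (G : sgraph) (A : {set G}) : edges_in A \subset edges G.
Proof. by apply/subsetP => f; rewrite inE => /andP[]. Qed.

Lemma star_sub (G : sgraph) (v : G) : star v \subset edges G.
Proof. by apply/subsetP => f; rewrite inE => /andP[]. Qed.

Lemma oddv_single (G : sgraph) (x y : G) :
  adj x y -> oddv [set [set x; y]] = [set x; y].
Proof.
move=> xy; apply/setP => z; rewrite inE /degree.
case: (boolP (z \in [set x; y])) => zxy.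
  rewrite (_ : [set f in _ | _] = [set [set x; y]]) ?cards1 //.
  by apply/setP => f; rewrite !inE; case: eqP => // ->; rewrite !inE in zxy *.
rewrite (_ : [set f in _ | _] = set0) ?cards0 //.
by apply/setP => f; rewrite !inE; case: eqP => // ->; rewrite !inE in zxy *; apply/negbTE.
Qed.

(** * Existence of joins *)

(** The edges of a walk, added mod 2, leave only its two ends odd. The target [symd [set x] [set y]]
    is empty when [x = y], so closed walks need no separate case. *)
Lemma join2 (G : sgraph) (E : {set {set G}}) (x y : G) : E \subset edges G ->
  connect [rel a b | [set a; b] \in E] x y ->
  exists2 F : {set {set G}}, F \subset E & oddv F = symd [set x] [set y].
Proof.
move=> EG /connectP[p]; elim: p x => [|z p IH] x /=.
  move=> _ ->; exists set0; rewrite ?sub0set // oddv0; apply/setP => z.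
  by rewrite in_symd addbb inE.
case/andP=> xzE /IH{}IH /IH[F FE oF]; exists (symd F [set [set x; z]]).
  by rewrite subset_symd // sub1set.
have xz : adj x z by rewrite -mem_edges (subsetP EG).
rewrite oddv_symd oF oddv_single //; apply/setP => w; rewrite !in_symd !inE.
case: (eqVneq w x) => [->|_]; last by case: (w == z); case: (w == y).
by rewrite (negPf (adj_neq xz)); case: (x == y).
Qed.

(** Induction on [#|T|]: two vertices of [T] are dropped, the rest is joined, and a walk between the
    two is added. Edges of [E] may leave [A]; only the vertices of [A] have to be linked through
    [E]. *)
Lemma tjoin (G : sgraph) (E : {set {set G}}) (A T : {set G}) :
  E \subset edges G ->
  {in A &, forall x y, connect [rel a b | [set a; b] \in E] x y} ->
  T \subset A -> ~~ odd #|T| ->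
  exists2 F : {set {set G}}, F \subset E & oddv F = T.
Proof.
move=> EG cA; have [n] := ubnP #|T|; elim: n T => // n IH T ltTn TA eT.
have [->|[x xT]] := set_0Vmem T; first by exists set0; rewrite ?sub0set ?oddv0.
have [T1|[y]] := set_0Vmem (T :\ x).
  by move: eT; rewrite (cardsD1 x) xT T1 cards0.
rewrite !inE => /andP[yx yT].
have cT : #|T| = #|T :\ x :\ y|.+2 by rewrite (cardsD1 x) xT (cardsD1 y) !inE yx yT.
have [|||F FE oF] := IH (T :\ x :\ y).
- by rewrite cT ltnS in ltTn; apply: ltnW.
- by apply: subset_trans TA; rewrite (subset_trans (subD1set _ _)) ?subD1set.
- by rewrite cT /= negbK in eT.
have [F2 F2E oF2] := join2 EG (cA _ _ (subsetP TA _ xT) (subsetP TA _ yT)).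
exists (symd F F2); first exact: subset_symd.
rewrite oddv_symd oF oF2; apply/setP => z; rewrite !in_symd !inE.
case: (eqVneq z y) => [->|_]; first by rewrite yT (negPf yx).
by case: (eqVneq z x) => [->|_]; rewrite ?xT ?addbF ?andbT.
Qed.

Lemma tjoin_in (G : sgraph) (A T : {set G}) :
  connected_in A -> T \subset A -> ~~ odd #|T| ->
  exists2 F : {set {set G}}, F \subset edges_in A & oddv F = T.
Proof.
move=> cA; apply: tjoin; first exact: edges_in_sub.
move=> x y xA yA.
have := forall_inP (forall_inP cA x xA) y yA; rewrite (@eq_connect _ _ [rel a b | [set a; b] \in edges_in A]) //.
by move=> a b /=; rewrite inE mem_edges subUset !sub1set andbA [RHS]andbC.
Qed.

(* For [Q = set0] this yields a forest, encoded as an edge set without nonempty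
   even subset. *)
Lemma tjoin_min (G : sgraph) (E Q F0 : {set {set G}}) : F0 \subset E ->
  exists F : {set {set G}}, [/\ F \subset E, oddv F = oddv F0 &
    forall D : {set {set G}}, D \subset E -> D \subset F :|: Q -> oddv D = set0 -> D \subset Q].
Proof.
move=> F0E.
pose P (F : {set {set G}}) := (F \subset E) && (oddv F == oddv F0).
have P0 : P F0 by rewrite /P F0E eqxx.
case: (arg_minnP (fun F : {set {set G}} => #|F :\: Q|) P0) => F /andP[FE /eqP oF] minF.
exists F; split=> // D DE /subsetP DFQ oD; apply/subsetP => d dD; apply/negPn/negP => dQ.
have dF : d \in F by have := DFQ _ dD; rewrite inE (negPf dQ) orbF.
(* Adding [D] keeps the odd vertices, brings in no edge outside [Q] and removes [d], against the
   minimality of [F]. *)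
have := minF (symd F D); rewrite /P subset_symd // oddv_symd oD oF.
have -> : symd (oddv F0) set0 == oddv F0.
  by apply/eqP/setP => x; rewrite !inE addbF.
move=> /(_ isT); apply/negP; rewrite -ltnNge; apply: proper_card.
apply/properP; split.
  apply/subsetP => e; rewrite !inE => /andP[eQ]; rewrite eQ /=.
  case: (boolP (e \in F)) => //= eF eD.
  by have := DFQ _ eD; rewrite inE (negPf eF) (negPf eQ).
by exists d; rewrite !inE dQ dF // dD.
Qed.

Lemma eq_degree (G : sgraph) (E F : {set {set G}}) (x : G) :
  (forall f : {set G}, x \in f -> (f \in E) = (f \in F)) -> degree E x = degree F x.
Proof.
move=> EF; apply: eq_card => f; rewrite !inE.
by case: (boolP (x \in f)) => [/EF->|_]; rewrite ?andbF.
Qed.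

(** * Connected partitions *)

Definition induced (G : sgraph) (A : {set G}) : rel G :=
  [rel u v | [&& u \in A, v \in A & adj u v]].

Definition component (G : sgraph) (A : {set G}) (b : G) : {set G} :=
  [set x | connect (induced A) b x].

Lemma induced_closed (G : sgraph) (A D : {set G}) : D \subset A ->
  {in D & A :\: D, forall x y, ~~ adj x y} -> closed (induced A) (mem D).
Proof.
move=> DA nc x y /and3P[xA yA xy]; apply/idP/idP => [xD|yD]; apply/negPn/negP => nD.
  by have := nc x y xD; rewrite !inE nD yA => /(_ isT); rewrite xy.
by have := nc y x yD; rewrite !inE nD xA => /(_ isT); rewrite adj_sym xy.
Qed.

(** A set that no edge leaves within [A] is closed under [induced A], so it contains all that is
    reachable from its points. With the converse [cut_connected], connectivity is handled below
    through cuts. *)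
Lemma connected_cut (G : sgraph) (A D : {set G}) :
  connected_in A -> D \subset A -> D != set0 -> D != A ->
  exists x y, [/\ x \in D, y \in A, y \notin D & adj x y].
Proof.
move=> cA DA /set0Pn[a aD] DnA.
have [b bA bD] : exists2 b, b \in A & b \notin D.
  by apply/subsetPn; apply: contra DnA => AD; rewrite eqEsubset DA.
case: (boolP [exists x in D, exists y in A :\: D, adj x y]).
  move=> /exists_inP[x xD /exists_inP[y]]; rewrite inE => /andP[yD yA] xy.
  by exists x, y.
move=> nc.
have cl : closed (induced A) (mem D).
  apply: induced_closed => // x y xD yD; apply: contra nc => xy.
  by apply/exists_inP; exists x => //; apply/exists_inP; exists y.
have := closed_connect cl (forall_inP (forall_inP cA a (subsetP DA _ aD)) b bA).
by rewrite /= aD (negPf bD).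
Qed.

Lemma cut_connected (G : sgraph) (A : {set G}) :
  (forall D : {set G}, D \subset A -> D != set0 -> D != A ->
    exists x y, [/\ x \in D, y \in A, y \notin D & adj x y]) ->
  connected_in A.
Proof.
move=> cut; apply/forall_inP => x xA; apply/forall_inP => y yA.
apply/negPn/negP => nxy.
pose D := [set z in A | connect (induced A) x z].
have [|||u [w []]] := cut D.
- by apply/subsetP => z; rewrite inE => /andP[].
- by apply/set0Pn; exists x; rewrite inE xA /= connect0.
- by apply/eqP => /setP/(_ y); rewrite inE yA /= (negPf nxy).
rewrite !inE => /andP[uA xu] wA; rewrite wA /= => /negP nw uw; apply: nw.
by apply: connect_trans xu (connect1 _); apply/and3P.
Qed.

Lemma component_id (G : sgraph) (A : {set G}) b : b \in component A b.
Proof. by rewrite inE connect0. Qed.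

Lemma component_sub (G : sgraph) (A : {set G}) b : b \in A -> component A b \subset A.
Proof.
move=> bA; apply/subsetP => x; rewrite inE => bx.
have cl : closed (induced A) (mem A) by move=> u w /and3P[uA wA _]; rewrite /= uA wA.
by rewrite -(closed_connect cl bx).
Qed.

Lemma component_closed (G : sgraph) (A : {set G}) b u w : b \in A ->
  u \in component A b -> w \in A -> adj u w -> w \in component A b.
Proof.
move=> bA uC wA uw; have uA := subsetP (component_sub bA) _ uC.
move: uC; rewrite !inE => bu; apply: connect_trans bu (connect1 _).
by apply/and3P.
Qed.

(** No edge leaves the component within [A], so a part of it that is closed in the component is
    closed in [A] and contains all that is reachable from [b]. *)
Lemma component_connected (G : sgraph) (A : {set G}) b :
  b \in A -> connected_in (component A b).
Proof.
move=> bA; apply: cut_connected => D DC /set0Pn[a aD] DnC.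
have CA := component_sub bA.
case: (boolP [exists x in D, exists y in component A b :\: D, adj x y]).
  move=> /exists_inP[x xD /exists_inP[y]]; rewrite inE => /andP[yD yA] xy.
  by exists x, y.
move=> nc; case/negP: DnC; rewrite eqEsubset DC.
have cl : closed (induced A) (mem D).
  apply: induced_closed => [|x y xD]; first exact: subset_trans CA.
  rewrite inE => /andP[yD yA]; apply: contra nc => xy.
  apply/exists_inP; exists x => //; apply/exists_inP; exists y => //.
  by rewrite inE yD (component_closed bA (subsetP DC _ xD)).
have bD : b \in D.
  by have := subsetP DC _ aD; rewrite inE => /(closed_connect cl) /= ->.
by apply/subsetP => x; rewrite inE => /(closed_connect cl) /= <-.
Qed.

Lemma component_max (G : sgraph) (A D : {set G}) b :
  connected_in D -> D \subset A -> b \in D -> D \subset component A b.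
Proof.
move=> cD DA bD; have bA := subsetP DA _ bD.
apply/negPn/negP => nDC.
have [||u [w []]] := connected_cut cD (subsetIl D (component A b)).
- by apply/set0Pn; exists b; rewrite inE bD component_id.
- by apply: contra nDC => /eqP <-; apply: subsetIr.
rewrite inE => /andP[uD uC] wD; rewrite inE wD /= => /negP nw uw; apply: nw.
exact: component_closed bA uC (subsetP DA _ wD) uw.
Qed.

Lemma connected_add (G : sgraph) (A : {set G}) x a :
  connected_in A -> a \in A -> adj x a -> connected_in (x |: A).
Proof.
move=> cA aA xa; case: (boolP (x \in A)) => xA.
  by rewrite (_ : x |: A = A) //; apply/setUidPr; rewrite sub1set.
apply: cut_connected => D DxA D0 DnxA.
have [DA|DA] := eqVneq (D :&: A) set0.
  have DE : D = [set x].
    apply/eqP; rewrite eqEsubset; apply/andP; split.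
      apply/subsetP => z zD; have := subsetP DxA _ zD; rewrite !inE => /orP[//|zA].
      by have := in_set0 z; rewrite -DA inE zD zA.
    case/set0Pn: D0 => z zD; rewrite sub1set.
    have := subsetP DxA _ zD; rewrite !inE => /orP[/eqP <-//|zA].
    by have := in_set0 z; rewrite -DA inE zD zA.
  exists x, a; rewrite DE !inE eqxx aA orbT; split=> //.
  by apply: contra xA => /eqP <-.
have [AD|AD] := boolP (A \subset D).
  have xD : x \notin D.
    apply: contra DnxA => xD; rewrite eqEsubset DxA /=.
    by rewrite subUset sub1set xD.
  exists a, x; rewrite (subsetP AD) // !inE eqxx xD adj_sym xa; split=> //.
have [|u [w []]] := connected_cut cA (subsetIr D A) DA.
  by apply: contra AD => /eqP <-; apply: subsetIl.
rewrite inE => /andP[uD uA] wA; rewrite inE wA andbT => wD uw.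
by exists u, w; rewrite uD wD uw !inE wA orbT.
Qed.

(* Among the vertices of [C :\ b] with a neighbour in [K], one that maximizes
   the component of [b] left after its deletion does not cut [C]. *)
Lemma peel (G : sgraph) (C K : {set G}) b :
  connected_in C -> K != set0 -> [disjoint C & K] ->
  (forall x, connected_in ((C :|: K) :\ x)) -> b \in C -> C != [set b] ->
  exists x, [/\ x \in C, x != b, connected_in (C :\ x) & exists2 k, k \in K & adj x k].
Proof.
move=> cC K0 dCK c2 bC Cb.
have CnK z : z \in C -> z \notin K by move=> zC; rewrite (disjointFr dCK zC).
pose P x := [&& x \in C, x != b & [exists k in K, adj x k]].
have [x0 P0] : exists x, P x.
  have [|||u [w []]] := @connected_cut _ _ (C :\ b) (c2 b).
  - by apply: setSD; apply: subsetUl.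
  - apply: contra Cb; rewrite setD_eq0 => Cb; rewrite eqEsubset Cb.
    by rewrite sub1set.
  - case/set0Pn: K0 => k kK; apply/eqP => /setP/(_ k); rewrite !inE kK orbT andbT.
    case: (eqVneq k b) => [kb|kb] /=; last by move=> kC; have := CnK k; rewrite kC kK => /(_ isT).
    by have := CnK b bC; rewrite -kb kK.
  rewrite !inE => /andP[ub uC] /andP[wb wCK]; rewrite wb /= => wC uw.
  exists u; rewrite /P uC ub; apply/exists_inP; exists w => //.
  by move: wCK; rewrite (negPf wC).
case: (arg_maxnP (fun x => #|component (C :\ x) b|) P0) => x /and3P[xC xb /exists_inP[k kK xk]] xmax.
exists x; split=> //; last by exists k.
have bCx : b \in C :\ x by rewrite !inE bC eq_sym xb.
set D := component (C :\ x) b in xmax.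
have DCx : D \subset C :\ x := component_sub bCx.
have [<-|DnC] := eqVneq D (C :\ x); first exact: component_connected.
(* The rest of [C :\ x] has no edge to the component [D], so an edge leaving it in [(C :|: K) :\ x]
   ends in [K]. Its inner end [y] therefore competes with [x]. *)
have [|||y [w []]] := @connected_cut _ _ ((C :\ x) :\: D) (c2 x).
- by apply: subset_trans (subsetDl _ _) _; apply: setSD; apply: subsetUl.
- by apply: contra DnC; rewrite setD_eq0 eqEsubset DCx.
- apply/eqP => /setP/(_ b); rewrite !inE connect0 bC /= eq_sym xb.
  done.
rewrite !inE => /and3P[yD yx yC] /andP[wx wCK]; rewrite wx /= negb_and negbK => wD yw.
have wK : w \in K.
  case/orP: wCK => // wC; rewrite wC orbF in wD.
  case/negP: yD; have := @component_closed G _ b w y bCx.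
  by rewrite !inE yx yC adj_sym yw wD; apply.
have yb : y != b by apply: contra yD => /eqP ->; rewrite connect0.
have /xmax : P y by rewrite /P yC yb; apply/exists_inP; exists w.
move=> le; exfalso; move: le; apply/negP; rewrite -ltnNge.
have bCy : b \in C :\ y by rewrite !inE bC eq_sym yb.
have DCy : D \subset C :\ y.
  apply/subsetP => z zD; have := subsetP DCx _ zD; rewrite !inE => /andP[_ ->].
  by rewrite andbT; apply: contra yD => /eqP <-; rewrite inE in zD.
have DE : D \subset component (C :\ y) b.
  by apply: component_max => //; [apply: component_connected|apply: component_id].
apply: proper_card; apply/properP; split=> //; exists x; last first.
  by apply/negP => /(subsetP DCx); rewrite !inE eqxx.
(* An edge leaving [D] within [C] can only end in [x]. As [y] is outside [D], the component of [b]
   in [C :\ y] contains [D] and [x], against the maximality of [D]. *)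
have [|||u [z []]] := @connected_cut _ _ D cC.
- by apply: subset_trans DCx _; apply: subsetDl.
- by apply/set0Pn; exists b; apply: component_id.
- by apply/eqP => DC; have := subsetP DCx x; rewrite DC xC !inE eqxx => /(_ isT).
move=> uD zC zD uz; have zx : z = x.
  apply/eqP; apply: contraNT zD => zx; apply: (component_closed bCx uD) => //.
  by rewrite !inE zx.
rewrite -zx; apply: (component_closed bCy (subsetP DE _ uD)) => //.
by rewrite zx !inE xC eq_sym yx.
Qed.

Definition biconnected (G : sgraph) (J : {set G}) : Prop :=
  connected_in J /\ forall x, connected_in (J :\ x).

(* Peel the vertices of [J] one by one, from [p] to [r]: those peeled before [y]
   and those peeled after it are the two sets. *)
Lemma fan (G : sgraph) (J : {set G}) p r y : biconnected J ->
  p \in J -> r \in J -> y \in J -> p != r -> p != y -> r != y ->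
  exists N1 N2 : {set G}, [/\ [/\ N1 \subset J, N2 \subset J & [disjoint N1 & N2]],
    y \notin N1 :|: N2, p \in N1, r \in N2 &
    connected_in (y |: N1) /\ connected_in (y |: N2)].
Proof.
move=> [cJ c2] pJ rJ yJ pr py ry.
suff H n : forall C K : {set G}, #|C| <= n -> connected_in C -> connected_in K ->
    [disjoint C & K] -> C :|: K = J -> p \in K -> r \in C -> y \in C ->
    exists N1 N2 : {set G}, [/\ [/\ N1 \subset J, N2 \subset J & [disjoint N1 & N2]],
    y \notin N1 :|: N2, p \in N1, r \in N2 &
    connected_in (y |: N1) /\ connected_in (y |: N2)].
  apply: (H #|J| (J :\ p) [set p]) => //.
  - by rewrite subset_leq_card // subD1set.
  - by apply/forall_inP => a /set1P ->; apply/forall_inP => b /set1P ->; apply: connect0.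
  - by rewrite disjoint_sym disjoints1 !inE eqxx.
  - by rewrite setUC setD1K.
  - by rewrite inE.
  - by rewrite !inE eq_sym pr.
  - by rewrite !inE eq_sym py.
elim: n => [|n IH] C K; first by rewrite leqn0 cards_eq0 => /eqP -> _ _ _ _ _; rewrite inE.
move=> szC cC cK dCK CK pK rC yC.
have [|||||x [xC xr cCx [k kK xk]]] := @peel G C K r cC.
- by apply/set0Pn; exists p.
- by [].
- by rewrite CK.
- by [].
- by apply/eqP => CE; move: yC; rewrite CE inE eq_sym (negPf ry).
have [xy|xy] := eqVneq x y.
  (* [K] holds the vertices peeled before [y], and [k] attaches [y] to it; the other set together
     with [y] is the connected set [C]. *)
  subst x; exists K, (C :\ y); split; [split|..] => //.
  - by rewrite -CK subsetUr.
  - by apply: subset_trans (subD1set _ _) _; rewrite -CK subsetUl.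
  - by rewrite disjoint_sym (disjointWl (subD1set _ _)).
  - by rewrite !inE eqxx orbF (disjointFr dCK yC).
  - by rewrite !inE ry.
  - by split; [apply: connected_add xk | rewrite setD1K].
apply: (IH (C :\ x) (x |: K)) => //.
- by move: szC; rewrite (cardsD1 x) xC.
- exact: connected_add xk.
- rewrite -setI_eq0; apply/eqP/setP => z; rewrite !inE.
  case: (eqVneq z x) => //= _; case: (boolP (z \in C)) => //= zC.
  by rewrite (disjointFr dCK zC).
- by rewrite -CK setUA (setUC (C :\ x)) setD1K.
- by rewrite !inE pK orbT.
- by rewrite !inE eq_sym xr.
- by rewrite !inE eq_sym xy.
Qed.

(** Vertices are moved from [C] to [K] with [peel], protecting a vertex of [B] while [A] meets [C]
    more than once, and then a vertex of [A] while [B] does. Neither intersection becomes empty, and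
    the process stops when both are singletons. *)
Lemma split_one_one (G : sgraph) (J A B : {set G}) : biconnected J ->
  A \subset J -> B \subset J -> A != set0 -> 1 < #|B| ->
  exists C K : {set G}, [/\ connected_in C /\ connected_in K, [disjoint C & K],
    C :|: K = J, #|A :&: C| = 1 & #|B :&: C| = 1].
Proof.
move=> [cJ c2] AJ BJ /set0Pn[a0 a0A] B2.
suff H n : forall C K : {set G}, #|C| <= n -> connected_in C -> connected_in K ->
    [disjoint C & K] -> C :|: K = J -> K != set0 -> A :&: C != set0 -> B :&: C != set0 ->
    exists C K : {set G}, [/\ connected_in C /\ connected_in K, [disjoint C & K],
    C :|: K = J, #|A :&: C| = 1 & #|B :&: C| = 1].
  (* The vertex [s] is the initial [K]: its complement keeps [a0] from [A] and, as [1 < #|B|], some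
     vertex of [B]. *)
  have [s sB sa0] : exists2 s, s \in B & s != a0.
    case/card_gt1P: B2 => b1 [b2 [b1B b2B b12]].
    case: (eqVneq b1 a0) => [e|]; last by exists b1.
    by exists b2; rewrite // -e eq_sym.
  have sJ := subsetP BJ _ sB.
  apply: (H #|J| (J :\ s) [set s]) => //.
  - by rewrite subset_leq_card // subD1set.
  - by apply/forall_inP => a /set1P ->; apply/forall_inP => b /set1P ->; apply: connect0.
  - by rewrite disjoint_sym disjoints1 !inE eqxx.
  - by rewrite setUC setD1K.
  - by apply/set0Pn; exists s; rewrite inE.
  - by apply/set0Pn; exists a0; rewrite !inE a0A eq_sym sa0 (subsetP AJ).
  - have : 0 < #|B :\ s| by rewrite (cardsD1 s) sB in B2.
    rewrite card_gt0 => /set0Pn[b]; rewrite !inE => /andP[bs bB]; apply/set0Pn.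
    by exists b; rewrite !inE bB bs (subsetP BJ).
elim: n => [|n IH] C K.
  by rewrite leqn0 cards_eq0 => /eqP -> _ _ _ _ _; rewrite setI0 eqxx.
move=> szC cC cK dCK CK K0 /set0Pn[a] /setIP[aA aC] /set0Pn[b] /setIP[bB bC].
have step x : x \in C -> connected_in (C :\ x) -> (exists2 k, k \in K & adj x k) ->
    A :&: (C :\ x) != set0 -> B :&: (C :\ x) != set0 ->
    exists C K : {set G}, [/\ connected_in C /\ connected_in K, [disjoint C & K],
    C :|: K = J, #|A :&: C| = 1 & #|B :&: C| = 1].
  move=> xC cCx [k kK xk] Ax Bx; apply: (IH (C :\ x) (x |: K)) => //.
  - by move: szC; rewrite (cardsD1 x) xC.
  - exact: connected_add xk.
  - rewrite -setI_eq0; apply/eqP/setP => z; rewrite !inE.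
    case: (eqVneq z x) => //= _; case: (boolP (z \in C)) => //= zC.
    by rewrite (disjointFr dCK zC).
  - by rewrite -CK setUA (setUC (C :\ x)) setD1K.
  - by apply/set0Pn; exists x; rewrite !inE eqxx.
have two (S : {set G}) x : 1 < #|S :&: C| -> S :&: (C :\ x) != set0.
  move=> S2; have : 0 < #|(S :&: C) :\ x|.
    by move: S2; rewrite (cardsD1 x); case: (x \in _) => // /ltnW.
  rewrite card_gt0 => /set0Pn[z]; rewrite !inE => /and3P[zx zS zC].
  by apply/set0Pn; exists z; rewrite !inE zx zS zC.
have big (S : {set G}) c : 1 < #|S :&: C| -> C != [set c].
  apply: contraTneq => ->; rewrite -leqNgt -(cards1 c); apply: subset_leq_card; exact: subsetIr.
have c2' x : connected_in ((C :|: K) :\ x) by rewrite CK.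
have pos (S : {set G}) c : c \in S -> c \in C -> 0 < #|S :&: C|.
  by move=> cS cC'; apply/card_gt0P; exists c; rewrite inE cS.
have [A2|A1] := ltnP 1 #|A :&: C|.
  have [x [xC xb cx kx]] := peel cC K0 dCK c2' bC (big _ b A2).
  apply: (step x) => //; first exact: two.
  by apply/set0Pn; exists b; rewrite !inE bB bC eq_sym xb.
have [B2'|B1] := ltnP 1 #|B :&: C|.
  have [x [xC xa cx kx]] := peel cC K0 dCK c2' aC (big _ a B2').
  apply: (step x) => //; last exact: two.
  by apply/set0Pn; exists a; rewrite !inE aA aC eq_sym xa.
exists C, K; split=> //; apply/eqP; rewrite eqn_leq ?A1 ?B1 /=.
  exact: pos aA aC.
exact: pos bB bC.
Qed.

(** * Forests *)

(* [E |-> oddv E] is injective on the subsets of [F], its values are subsets of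
   [cover F], and by the handshake lemma it misses the singletons; hence
   [F] has fewer edges than vertices. *)
Lemma forest_leaf (G : sgraph) (F : {set {set G}}) : F \subset edges G ->
  (forall E : {set {set G}}, E \subset F -> oddv E = set0 -> E = set0) -> F != set0 ->
  exists y, degree F y = 1.
Proof.
move=> FE evenfree F0.
case: (boolP [exists y, degree F y == 1]) => [/existsP[y /eqP]|]; first by exists y.
rewrite negb_exists => /forallP no1; exfalso.
(* Without vertices of degree 1, every vertex of [cover F] has degree at least 2. *)
have cov : #|cover F| <= #|F|.
  rewrite -leq_double -sum_degree // -mul2n mulnC -sum_nat_const big_mkcond /=.
  apply: leq_sum => x _; case: ifP => // xF; have := no1 x.
  by rewrite -degree_gt0 in xF; case: (degree F x) xF => [|[]].
have inj : {in powerset F &, injective (@oddv G)}.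
  move=> E1 E2; rewrite !inE => E1F E2F oE.
  have /setP s0 : symd E1 E2 = set0.
    apply: evenfree; first exact: subset_symd.
    by rewrite oddv_symd oE; apply/setP => x; rewrite in_symd addbb inE.
  by apply/setP => f; have := s0 f; rewrite in_symd inE; do 2!case: (_ \in _).
have [x0 x0F] : exists x, x \in cover F.
  case/set0Pn: F0 => f fF; have := card_edge (subsetP FE _ fF).
  move/eqP; case: (set_0Vmem f) => [->|[x xf] _]; first by rewrite cards0.
  by exists x; apply/bigcupP; exists f.
have : @oddv G @: powerset F \proper powerset (cover F).
  apply/properP; split.
    apply/subsetP => _ /imsetP[E EF ->]; rewrite inE in EF; rewrite inE.
    apply/subsetP => x /oddv_sub_cover/bigcupP[f fE xf]; apply/bigcupP.
    by exists f => //; apply: (subsetP EF).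
  exists [set x0]; first by rewrite inE sub1set.
  apply/negP => /imsetP[E EF oE]; rewrite inE in EF.
  by have := handshake (subset_trans EF FE); rewrite -oE cards1.
move/proper_card; rewrite card_in_imset // !card_powerset ltn_exp2l //.
by rewrite ltnNge cov.
Qed.

(** The condition on a colour class at one vertex; 0 is the degree of a vertex that the class does
    not touch. *)
Definition odd_or0 (n : nat) : bool := odd n || (n == 0).

Lemma degreeU (G : sgraph) (E F : {set {set G}}) (x : G) :
  [disjoint E & F] -> degree (E :|: F) x = degree E x + degree F x.
Proof.
move=> dEF; rewrite (@degreeD _ _ E) ?subsetUl //; congr (_ + degree _ _).
by rewrite setDUl setDv set0U; apply/setDidPl; rewrite disjoint_sym.
Qed.

(** Call free the vertex [v], where no condition is imposed, and the leaves of [R], which are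
    correct in either colour. The edges without a free end form a forest; a leaf [y] of it has a
    single edge of [R] that does not lead to a free vertex. If this forest is empty, some [y] has
    all its edges leading to free vertices. *)
Lemma forest_peel (G : sgraph) (v : G) (R : {set {set G}}) :
  R \subset edges G ->
  (forall E : {set {set G}}, E \subset R -> v \notin cover E -> oddv E = set0 -> E = set0) ->
  R != set0 ->
  exists y (L : {set {set G}}), [/\ y != v, L \subset R, L != set0, degree (R :\: L) y <= 1 &
    forall f, f \in L -> y \in f /\
      forall x, x \in f -> x != y -> (x == v) || (degree R x == 1)].
Proof.
move=> RE evenfree R0.
pose free x := (x == v) || (degree R x == 1).
pose Ly y := [set f in R | (y \in f) && [exists x in f, (x != y) && free x]].
have LyP y f : f \in Ly y -> y \in f /\ forall x, x \in f -> x != y -> free x.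
  rewrite inE => /and3P[fR yf /exists_inP[z zf /andP[zy fz]]]; split=> // x xf xy.
  have [w yw fE] := edgeP (subsetP RE _ fR) yf.
  move: zf xf; rewrite fE !inE (negPf zy) (negPf xy) /= => /eqP zw /eqP ->.
  by rewrite -zw.
have LyR y : Ly y \subset R by apply/subsetP => f; rewrite inE => /and3P[].
suff [y [yv Ly0 dy]] : exists y, [/\ y != v, Ly y != set0 & degree (R :\: Ly y) y <= 1].
  by exists y, (Ly y); split=> // f /LyP.
pose Rs := [set f in R | [forall x in f, ~~ free x]].
have RsR : Rs \subset R by apply/subsetP => f; rewrite inE => /andP[].
have [Rs0|Rs0] := eqVneq Rs set0.
  have exf f : f \in R -> exists2 x, x \in f & free x.
    move=> fR; have := in_set0 f; rewrite -Rs0 inE fR /= => /negbT.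
    by rewrite negb_forall_in => /exists_inP[x xf]; rewrite negbK; exists x.
  have [y [z [yv yzR zy fz]]] : exists y z, [/\ y != v, [set y; z] \in R, z != y & free z].
    case/set0Pn: R0 => e eR; have [x xe fx] := exf e eR.
    have [y xy eE] := edgeP (subsetP RE _ eR) xe.
    have xny := adj_neq xy.
    have [yv|yv] := eqVneq y v; last by exists y, x; rewrite setUC -eE.
    exists x, y; rewrite -eE eR (eq_sym y) xny /free yv eqxx; split=> //.
    by rewrite -yv.
  exists y; split=> //.
    apply/set0Pn; exists [set y; z]; rewrite inE yzR set21; apply/exists_inP.
    by exists z; rewrite ?set22 ?zy.
  suff -> : degree (R :\: Ly y) y = 0 by [].
  apply/eqP; rewrite degree_eq0; apply/notin_coverP => f; rewrite inE => /andP[fL fR].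
  apply: contra fL => yf; rewrite inE fR yf; have [x xf fx] := exf f fR.
  (* If the free end of [f] is [y] itself, then [y] has degree 1 in [R], so [f] is the edge to the
     free vertex [z]. *)
  have [xy|xy] := eqVneq x y; last by apply/exists_inP; exists x; rewrite ?xy.
  move: fx; rewrite xy /free (negPf yv) /= => /cards1P[e0 eE].
  have fe : f = [set y; z].
    have : f \in [set e0] by rewrite -eE inE fR.
    have : [set y; z] \in [set e0] by rewrite -eE inE yzR set21.
    by rewrite !inE => /eqP -> /eqP.
  by apply/exists_inP; exists z; rewrite ?fe ?set22 ?zy.
have vRs : v \notin cover Rs.
  apply/notin_coverP => f; rewrite inE => /andP[_ /forall_inP nf].
  by apply/negP => /nf; rewrite /free eqxx.
have [|||y dy] := @forest_leaf _ Rs; last 1 first.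
- have yv : y != v.
    by apply: contra vRs => /eqP <-; rewrite -degree_gt0 dy.
  have /bigcupP[f0 f0Rs yf0] : y \in cover Rs by rewrite -degree_gt0 dy.
  have fy : ~~ free y by move: f0Rs; rewrite inE => /andP[_ /forall_inP]; apply.
  have dle : degree (R :\: Ly y) y <= 1.
    rewrite -dy; apply: subset_leq_card; apply/subsetP => f.
    rewrite !inE => /andP[/andP[fL fR] yf]; rewrite fR yf andbT /=.
    apply/forall_inP => x xf; apply: contra fL => fx; rewrite fR yf /=.
    apply/exists_inP; exists x => //; rewrite fx andbT.
    by apply: contra fy => /eqP <-.
  (* If [Ly y] were empty, [y] would have degree 1 in [R] and be free. *)
  exists y; split=> //; apply: contra fy => /eqP L0.
  rewrite L0 setD0 in dle; rewrite /free eqn_leq dle /= degree_gt0.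
  by apply/orP; right; apply/bigcupP; exists f0 => //; apply: (subsetP RsR).
- exact: subset_trans RE.
- move=> E ERs; apply: evenfree; first exact: subset_trans RsR.
  by apply/notin_coverP => f /(subsetP ERs) fRs; apply: (notin_coverP _ _ vRs).
- by [].
Qed.

(** Induction with [forest_peel]: after colouring [R :\: L], the edges of [L] can be coloured at
    will, since their ends other than [y] are [v] or leaves, and [y] meets at most one coloured
    edge. *)
Lemma forest_coloring (G : sgraph) (v : G) (R : {set {set G}}) :
  R \subset edges G ->
  (forall E : {set {set G}}, E \subset R -> v \notin cover E -> oddv E = set0 -> E = set0) ->
  exists2 J : {set {set G}}, J \subset R & forall x, x != v ->
    odd_or0 (degree J x) && odd_or0 (degree (R :\: J) x).
Proof.
have [n] := ubnP #|R|; elim: n R => // n IH R ltRn RE evenfree.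
have [->|R0] := eqVneq R set0.
  exists set0; rewrite ?sub0set // => x _; rewrite setD0 andbb.
  suff -> : degree set0 x = 0 by [].
  by apply/eqP; rewrite degree_eq0; apply/notin_coverP => f; rewrite inE.
have [y [L [yv LR L0 d1 Lfree]]] := forest_peel RE evenfree R0.
have R'R : R :\: L \subset R by apply: subsetDl.
have [|||J0 J0R ok] := IH (R :\: L).
- rewrite ltnS in ltRn; apply: leq_trans ltRn; apply: proper_card.
  apply/properP; split=> //; case/set0Pn: L0 => f fL; exists f; first exact: (subsetP LR).
  by rewrite inE fL.
- exact: subset_trans RE.
- by move=> E ER; apply: evenfree; apply: subset_trans R'R.
(* If [#|L|] is odd, all of [L] gets a colour absent at [y]. If it is even, [L] gets the colour
   present at [y], or is split into one edge and the rest when no colour is present. *)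
have [L' L'L okL] : exists2 L' : {set {set G}}, L' \subset L &
    odd_or0 (degree J0 y + #|L'|) && odd_or0 (degree (R :\: L :\: J0) y + (#|L| - #|L'|)).
  move: d1; rewrite (degreeD _ J0R); case/set0Pn: L0 => f fL.
  have k0 : 0 < #|L| by apply/card_gt0P; exists f.
  case: (degree J0 y) => [|[|j0]] //; case: (degree _ y) => [|[|l0]] // _;
    case: (boolP (odd #|L|)) => oL.
  - by exists L; rewrite // subnn /odd_or0 add0n oL.
  - exists [set f]; rewrite ?sub1set // cards1 /odd_or0 add0n.
    by rewrite oddB // (negPf oL).
  - by exists L; rewrite // subnn /odd_or0 add0n oL.
  - by exists set0; rewrite ?sub0set // cards0 subn0 /odd_or0 add0n /= oL.
  - by exists set0; rewrite ?sub0set // cards0 subn0 /odd_or0 add0n /= oL.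
  - by exists L; rewrite // subnn /odd_or0 add1n /= oL.
have dJ0L : [disjoint J0 & L].
  rewrite -setI_eq0; apply/eqP/setP => f; rewrite !inE; apply/negbTE/negP => /andP[fJ fL].
  by have := subsetP J0R _ fJ; rewrite inE fL.
have JR : J0 :|: L' \subset R.
  by rewrite subUset (subset_trans J0R) // (subset_trans L'L).
have dJ x : degree (J0 :|: L') x = degree J0 x + degree L' x.
  by apply: degreeU; apply: disjointWr L'L dJ0L.
have dRJ x : degree (R :\: (J0 :|: L')) x = degree (R :\: L :\: J0) x + degree (L :\: L') x.
  rewrite -degreeU; last first.
    rewrite -setI_eq0; apply/eqP/setP => f; rewrite !inE.
    by case: (f \in L); rewrite ?andbF.
  congr degree; apply/setP => f; rewrite !inE.
  have /implyP := subsetP LR f; have /implyP := subsetP L'L f.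
  have : ~~ ((f \in J0) && (f \in L)) by apply/andP => -[/(disjointFr dJ0L) ->].
  by case: (f \in J0); case: (f \in L); case: (f \in L'); case: (f \in R).
have dL' (M : {set {set G}}) : M \subset L -> degree M y = #|M|.
  move=> ML; apply: eq_card => f; rewrite inE; case: (boolP (f \in M)) => //= fM.
  by case: (Lfree f (subsetP ML _ fM)).
exists (J0 :|: L') => // x xv.
have [->|xy] := eqVneq x y.
  rewrite dJ dRJ (dL' _ L'L) (dL' _ (subsetDl _ _)) cardsD.
  by rewrite (setIidPr L'L).
have [/bigcupP[f fL xf]|xL] := boolP (x \in cover L).
  have /= := (Lfree f fL).2 x xf xy; rewrite (negPf xv) /= (degreeD _ JR).
  by case: (degree _ x) => [|[|?]]; case: (degree _ x) => [|[|?]].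
have z0 (M : {set {set G}}) : M \subset L -> degree M x = 0.
  move=> ML; apply/eqP; rewrite degree_eq0; apply/notin_coverP => f /(subsetP ML).
  exact: (notin_coverP _ _ xL).
by rewrite dJ dRJ (z0 _ L'L) (z0 _ (subsetDl _ _)) !addn0 ok.
Qed.

(** * Colourings with an apex of even degree *)

Lemma colorable3 (G : sgraph) (R J : {set {set G}}) :
  R \subset edges G -> J \subset R ->
  (forall x, odd_or0 (degree (edges G :\: R) x)) ->
  (forall x, odd_or0 (degree J x)) ->
  (forall x, odd_or0 (degree (R :\: J) x)) ->
  odd_chromatic_index G <= 3.
Proof.
move=> RE JR ok0 ok1 ok2; rewrite odd_chromatic_index_le; apply/existsP.
pose c := [ffun f : edge G => if val f \in R then
  if val f \in J then inord 1 else inord 2 else inord 0 : 'I_3].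
have cE (F : {set {set G}}) i : F \subset edges G ->
    (forall f, (c f == i) = (val f \in F)) -> color_class c i = F.
  move=> FE cF; apply/setP => f; apply/imsetP/idP => [[g]|fF].
    by rewrite inE cF => gF ->.
  by exists (Sub f (subsetP FE _ fF)) => //; rewrite inE cF.
have ok F i : color_class c i = F -> (forall x, odd_or0 (degree F x)) ->
    (color_class c i != set0) ==> odd_graph (cover (color_class c i)) (color_class c i).
  move=> -> okF; apply/implyP => _; apply/forall_inP => x xF.
  by have := okF x; rewrite /odd_or0 degree_eq0 xF orbF.
exists c; apply/forallP => i.
have iE (a : 'I_3) k : k < 3 -> (inord k == a) = (k == a :> nat).
  by move=> k3; rewrite -val_eqE /= inordK.
case: i => [[|[|[|//]]] lti].
- apply: ok ok0; apply: cE; first exact: subsetDl.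
  move=> f; rewrite ffunE inE (valP f) andbT.
  by case: ifP => _; [case: ifP => _|]; rewrite iE.
- apply: ok ok1; apply: cE; first exact: subset_trans RE.
  move=> f; rewrite ffunE; have /implyP := subsetP JR (val f).
  by case: (_ \in R); case: (_ \in J); rewrite ?iE.
- apply: ok ok2; apply: cE; first exact: subset_trans (subsetDl _ _) RE.
  move=> f; rewrite ffunE inE.
  by case: ifP => _; [case: ifP => _|]; rewrite iE // andbF.
Qed.

Section Apex.

Variables (G : sgraph) (v : G) (F : {set {set G}}).
Hypotheses (v_even : v \in evenv G) (FE : F \subset edges G) (vF : v \notin cover F).

Lemma apex_sub : F :|: star v \subset edges G.
Proof. by rewrite subUset FE star_sub. Qed.

Lemma apex_degree x : degree (F :|: star v) x = degree F x + degree (star v) x.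
Proof.
apply: degreeU; rewrite -setI_eq0; apply/eqP/setP => f; rewrite !inE.
by apply/negbTE/and3P => -[fF _ vf]; have /negP := notin_coverP _ _ vF f fF.
Qed.

Lemma apex_degree_apex : degree (F :|: star v) v = degree (edges G) v.
Proof.
by rewrite apex_degree degree_star_id; move: vF; rewrite -degree_eq0 => /eqP ->.
Qed.

(** At [x] other than [v] the degrees in [F] and in the star add up to an odd number exactly when
    [x] has even degree, so removing both leaves an odd degree. At [v] the whole star is removed. *)
Lemma apex_rest : oddv F = symd (nbr v) (evenv G :\ v) ->
  forall x, odd_or0 (degree (edges G :\: (F :|: star v)) x).
Proof.
move=> oF x; have dx := degreeD x apex_sub.
have [xv|xv] := eqVneq x v.
  move/eqP: dx; rewrite xv apex_degree_apex -[X in X == _]addn0 eqn_add2l => /eqP <-.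
  by rewrite /odd_or0 orbT.
have := congr1 odd dx; rewrite oddD apex_degree oddD degree_star //.
have /setP/(_ x) := oF; rewrite in_symd !inE xv /= => ->.
by rewrite /odd_or0; case: (adj v x) => /=; do 2!case: (odd _).
Qed.

End Apex.

Lemma degree_sub0 (G : sgraph) (E F : {set {set G}}) x :
  E \subset F -> x \notin cover F -> degree E x = 0.
Proof.
move=> EF xF; apply/eqP; rewrite degree_eq0; apply/notin_coverP => f /(subsetP EF).
exact: (notin_coverP _ _ xF).
Qed.

Lemma evenv_odd (G : sgraph) : odd #|G| -> odd #|evenv G|.
Proof.
move=> oG; have := cardsC (evenv G); rewrite setCK => cG.
have := handshake (subxx (edges G)); move: oG; rewrite -cG oddD.
by case: (odd #|oddv _|) => //; rewrite addbF.
Qed.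

Lemma nbr_even (G : sgraph) (v : G) : v \in evenv G -> ~~ odd #|nbr v|.
Proof. by rewrite !inE degree_edges. Qed.

Lemma edges_in_cover (G : sgraph) (A : {set G}) (F : {set {set G}}) x :
  F \subset edges_in A -> x \in cover F -> x \in A.
Proof.
by move=> /subsetP FA /bigcupP[f /FA]; rewrite inE => /andP[_ /subsetP fA] /fA.
Qed.

Lemma edges_inS (G : sgraph) (A B : {set G}) :
  A \subset B -> edges_in A \subset edges_in B.
Proof.
move=> AB; apply/subsetP => f; rewrite !inE => /andP[-> fA].
exact: subset_trans AB.
Qed.

(** The parities allow the join to be taken inside [C] and [K] separately. Exchanging [J] and
    [R :\: J] on the edges that meet [C] then swaps the two degrees at each vertex of [C], keeps
    them on [K], and changes their parity at [v], which has an odd number of neighbours in [C]. *)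
Lemma colorable_split (G : sgraph) (v : G) (C K : {set G}) :
  odd #|G| -> v \in evenv G -> connected_in C -> connected_in K ->
  [disjoint C & K] -> C :|: K = [set~ v] ->
  odd #|nbr v :&: C| -> odd #|(evenv G :\ v) :&: C| ->
  odd_chromatic_index G <= 3.
Proof.
move=> oG v_even cC cK dCK CK oA oB.
pose T := symd (nbr v) (evenv G :\ v).
have TCE (S : {set G}) : T :&: S = symd (nbr v :&: S) ((evenv G :\ v) :&: S).
  by apply/setP => x; rewrite !inE; case: (x \in S); rewrite ?andbT ?andbF.
have TJ : T \subset [set~ v].
  by apply: subset_symd; apply/subsetP => x; rewrite !inE;
    [move=> vx; rewrite eq_sym (adj_neq vx) | case/andP].
have eT : ~~ odd #|T|.
  rewrite odd_card_symd (negPf (nbr_even v_even)) /=.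
  by have := evenv_odd oG; rewrite (cardsD1 v) v_even /=.
have eTC : ~~ odd #|T :&: C| by rewrite TCE odd_card_symd oA oB.
have eTK : ~~ odd #|T :&: K|.
  have dT : [disjoint T :&: C & T :&: K].
    by apply: disjointWl (subsetIr _ _) _; apply: disjointWr (subsetIr _ _) _.
  have TE : #|T| = #|T :&: C| + #|T :&: K|.
    have := cardsUI (T :&: C) (T :&: K).
    by rewrite -setIUr CK (setIidPl TJ) disjoint_setI0 // cards0 addn0.
  by move: eT; rewrite TE oddD (negPf eTC).
have [FC FCC oFC] := tjoin_in cC (subsetIr T C) eTC.
have [FK FKK oFK] := tjoin_in cK (subsetIr T K) eTK.
pose E := edges_in C :|: edges_in K.
have F0E : symd FC FK \subset E.
  by apply: subset_symd; [apply: subset_trans FCC _; apply: subsetUl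
    | apply: subset_trans FKK _; apply: subsetUr].
have [F [FsubE oF' minF]] := tjoin_min set0 F0E.
have oF : oddv F = T.
  rewrite oF' oddv_symd oFC oFK; apply/setP => x; rewrite in_symd !in_setI.
  have /setP/(_ x) := CK; have := subsetP TJ x; rewrite in_setU => TC CKx; move: TC; rewrite -CKx.
  case: (x \in T) => //= /(_ isT).
  by case: (boolP (x \in C)) => //= xC; rewrite (disjointFr dCK xC).
have EG : E \subset edges G by rewrite subUset !edges_in_sub.
have vCK : v \notin C :|: K by rewrite CK !inE eqxx.
have coverE f x : f \in E -> x \in f -> (f \subset C) && (x \in C) || (f \subset K) && (x \in K).
  by rewrite !inE => /orP[]/andP[_ fS] xf; rewrite fS (subsetP fS) //= orbT.
have vF : v \notin cover F.
  apply/notin_coverP => f fF; apply/negP => vf; move: vCK; rewrite inE.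
  by case/orP: (coverE f v (subsetP FsubE _ fF) vf) => /andP[_ ->]; rewrite ?orbT.
have FE := subset_trans FsubE EG.
set R := F :|: star v; have RE : R \subset edges G := apex_sub v FE.
(* A subset of [R] that avoids [v] lies in [F], a forest by minimality. *)
have [|J JR okJ] := @forest_coloring _ v R RE.
  move=> D DR vD oD; apply/eqP; rewrite -subset0.
  have DF : D \subset F.
    apply/subsetP => f fD; have := subsetP DR _ fD; rewrite !inE => /orP[//|/andP[_ vf]].
    by have /negP := notin_coverP _ _ vD f fD.
  by apply: minF => //; [apply: subset_trans FsubE | rewrite setU0].
(* [R] contains all edges at [v], an even number, so if one class is odd at [v], the other is
   too. *)
have finish (J' : {set {set G}}) : J' \subset R -> odd (degree J' v) -> (forall x, x != v ->
    odd_or0 (degree J' x) && odd_or0 (degree (R :\: J') x)) -> odd_chromatic_index G <= 3.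
  move=> J'R oJ' ok; have ev : odd (degree (R :\: J') v).
    have := congr1 odd (degreeD v J'R); rewrite apex_degree_apex // oddD oJ'.
    by move: v_even; rewrite !inE => /negPf -> /= /esym; case: (odd _).
  apply: (@colorable3 _ R J') => // [|x|x]; first exact: apex_rest.
    by have [->|/ok/andP[]//] := eqVneq x v; rewrite /odd_or0 oJ'.
  by have [->|/ok/andP[]//] := eqVneq x v; rewrite /odd_or0 ev.
have [oJ|eJ] := boolP (odd (degree J v)); first exact: (finish J).
pose RC := [set f in R | ~~ [disjoint f & C]].
have RCR : RC \subset R by apply/subsetP => f; rewrite inE => /andP[].
have RCf f x : f \in R -> x != v -> x \in f -> (f \in RC) = (x \in C).
  move=> fR xv xf; rewrite inE fR /=; move: (fR); rewrite inE => /orP[fF|].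
    case/orP: (coverE f x (subsetP FsubE _ fF) xf) => /andP[fS xS].
      by rewrite xS; apply/negP => /disjointFr/(_ xf); rewrite xS.
    by rewrite (disjointFl dCK xS) (disjointWl fS) // disjoint_sym.
  rewrite inE => /andP[fG vf]; have [w vw fE] := edgeP fG vf.
  move: xf; rewrite fE !inE (negPf xv) /= => /eqP ->.
  have vC : v \notin C by apply: contra vCK; rewrite inE => ->.
  rewrite -setI_eq0; apply/set0Pn/idP => [[z]|wC]; last by exists w; rewrite !inE eqxx orbT.
  by rewrite !inE => /andP[/orP[]/eqP -> //]; rewrite (negPf vC).
have oRC : odd (degree RC v).
  suff -> : degree RC v = #|nbr v :&: C| by [].
  rewrite -(card_imset _ (@set2_inj G v)); apply: eq_card => f.
  rewrite inE; apply/andP/imsetP => [[fRC vf]|[w]].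
    have fR := subsetP RCR _ fRC.
    have [w vw fE] := edgeP (subsetP RE _ fR) vf; exists w => //.
    have wv : w != v by rewrite eq_sym adj_neq.
    by rewrite !inE vw -(RCf f w fR wv) // fE set22.
  rewrite !inE => /andP[vw wC] ->; rewrite mem_edges vw set21 orbT; split=> //=.
  by apply/negP => /disjointFr/(_ (set22 v w)); rewrite wC.
apply: (finish (symd J RC)).
- exact: subset_symd.
- by rewrite odd_degree_symd oRC (negPf eJ).
- move=> x xv; have := okJ x xv.
  have RCE (f : {set G}) : x \in f -> (f \in RC) = (f \in R) && (x \in C).
    move=> xf; case: (boolP (f \in R)) => [fR|fR] /=; first exact: RCf.
    by apply: contraNF fR; apply: (subsetP RCR).
  have JRb (f : {set G}) : (f \in J) ==> (f \in R) by apply/implyP/(subsetP JR).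
  have [xC|xC] := boolP (x \in C).
    have -> : degree (symd J RC) x = degree (R :\: J) x.
      apply: eq_degree => f /RCE; rewrite in_symd in_setD xC => ->.
      by have := JRb f; case: (f \in J); case: (f \in R).
    have -> : degree (R :\: symd J RC) x = degree J x.
      apply: eq_degree => f /RCE; rewrite in_setD in_symd xC => ->.
      by have := JRb f; case: (f \in J); case: (f \in R).
    by rewrite andbC.
  have -> : degree (symd J RC) x = degree J x.
    by apply: eq_degree => f /RCE; rewrite in_symd (negPf xC) andbF => ->; rewrite addbF.
  suff -> : degree (R :\: symd J RC) x = degree (R :\: J) x by [].
  by apply: eq_degree => f /RCE; rewrite !in_setD in_symd (negPf xC) andbF => ->; rewrite addbF.
Qed.

(** * A single vertex of even degree *)

(** The classes are [H], an odd graph spanning [M]; [J], which contains all edges at [y], avoids [x]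
    and is odd at every other vertex; and the rest, which avoids [y] and is odd at every other
    vertex. *)
Lemma colorable_universal (G : sgraph) (v x y : G) :
  odd #|G| -> evenv G = [set v] -> (forall w, w != v -> adj v w) ->
  x != v -> y != v -> x != y -> ~~ adj x y ->
  connected_in (~: [set v; x; y]) -> odd_chromatic_index G <= 3.
Proof.
move=> oG ev univ xv yv xy nxy; set M := ~: _ => cM.
have degE w : odd (degree (edges G) w) = (w != v).
  by have /setP/(_ w) := ev; rewrite !inE => <-; rewrite negbK.
have MP z : (z \in M) = [&& z != v, z != x & z != y] by rewrite !inE !negb_or -andbA.
have eM : ~~ odd #|M|.
  have := cardsC M; rewrite setCK => cG; move: oG; rewrite -cG oddD.
  by rewrite -setUA cardsU1 cards2 !inE negb_or (eq_sym v) xv (eq_sym v) yv xy /= addbT.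
have [H HM oH] := tjoin_in cM (subxx M) eM.
have HE : H \subset edges G := subset_trans HM (edges_in_sub M).
pose W := ~: [set x; y]; pose R := edges G :\: H.
have RE : R \subset edges G := subsetDl _ _.
have WP z : (z \in W) = (z != x) && (z != y) by rewrite !inE negb_or.
(* These edges form a star spanning [W], disjoint from [H] because [H] avoids [v]. *)
pose E := edges_in W :&: star v.
have EG : E \subset edges G by apply: subset_trans (subsetIl _ _) (edges_in_sub W).
have vW : v \in W by rewrite WP eq_sym xv eq_sym yv.
have symE : connect_sym [rel a b | [set a; b] \in E].
  by apply: sym_connect_sym => a b /=; rewrite setUC.
have cv a : a \in W -> connect [rel a b | [set a; b] \in E] v a.
  move=> aW; have [->|av] := eqVneq a v; first exact: connect0.
  apply: connect1; rewrite /= inE [_ \in edges_in _]inE [_ \in star _]inE mem_edges.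
  by rewrite univ //= subUset !sub1set vW aW set21.
have oW : odd #|W|.
  have := cardsC W; rewrite setCK cards2 xy => cG; move: oG; rewrite -cG oddD /=.
  by rewrite addbF.
have nW : nbr y \subset W.
  apply/subsetP => z; rewrite inE WP => yz; rewrite (eq_sym z y) (adj_neq yz) andbT.
  by apply: contra nxy => /eqP <-; rewrite adj_sym.
(* [J'] corrects the star of [y] so that their sum is odd at every vertex of [W]. *)
have [|||J' J'E oJ'] := @tjoin _ E W (symd W (nbr y)) EG.
- by move=> a b aW bW; apply: connect_trans (cv b bW); rewrite symE cv.
- exact: subset_symd.
- by rewrite odd_card_symd oW -degree_edges degE yv.
pose J := symd (star y) J'.
have J'W : J' \subset edges_in W by apply: subset_trans J'E (subsetIl _ _).
have coverH z f : f \in H -> z \in f -> z \in M.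
  by move=> /(subsetP HM); rewrite inE => /andP[_ /subsetP fM] /fM.
have JR : J \subset R.
  apply: subset_symd; apply/subsetP => f fJ; rewrite inE; last first.
    rewrite (subsetP (subset_trans J'E EG)) // andbT.
    have := subsetP J'E _ fJ; rewrite inE => /andP[_]; rewrite inE => /andP[_ vf].
    by apply/negP => /coverH/(_ vf); rewrite MP eqxx.
  move: fJ; rewrite inE => /andP[-> yf]; rewrite andbT.
  by apply/negP => /coverH/(_ yf); rewrite MP eqxx !andbF.
have dR z : odd (degree R z) = (z != v) (+) (z \in M).
  have := congr1 odd (degreeD z HE); rewrite degE oddD.
  have /setP/(_ z) := oH; rewrite [_ \in oddv H]inE => -> ->.
  by rewrite -/R; case: (z \in M); case: (odd _).
have dJ z : z != y -> odd (degree J z) = (z \in W).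
  move=> zy; rewrite odd_degree_symd degree_star // oddb.
  have /setP/(_ z) := oJ'; rewrite [_ \in oddv J']inE in_symd [_ \in nbr _]inE => ->.
  by case: (adj y z); case: (z \in W).
have J'y : degree J' y = 0.
  apply/eqP; rewrite degree_eq0; apply/negP => /(edges_in_cover J'W).
  by rewrite WP eqxx andbF.
apply: (@colorable3 _ R J RE JR) => z.
- have -> : degree (edges G :\: R) z = degree H z.
    apply: eq_degree => f _; rewrite !in_setD.
    by have /implyP := subsetP HE f; case: (f \in H); case: (f \in edges G).
  have [zM|zM] := boolP (z \in M).
    by move: zM; rewrite -oH inE /odd_or0 => ->.
  suff /eqP -> : degree H z == 0 by [].
  by rewrite degree_eq0; apply: contra zM; apply: edges_in_cover.
- have [->|zy] := eqVneq z y.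
    by rewrite /odd_or0 odd_degree_symd J'y degree_star_id degE yv.
  have [zW|zW] := boolP (z \in W); first by rewrite /odd_or0 dJ ?zW.
  have -> : z = x by apply/eqP; move: zW; rewrite WP zy andbT negbK.
  suff /eqP -> : degree J x == 0 by [].
  rewrite degree_eq0; apply/notin_coverP => f; rewrite in_symd; apply: contraTN => xf.
  have -> : (f \in star y) = false.
    rewrite inE; apply/negP => /andP[fE yf]; have [w yw fE'] := edgeP fE yf.
    move: xf; rewrite fE' !inE (negPf xy) /= => /eqP xw; case/negP: nxy.
    by rewrite adj_sym xw.
  apply/negP => /(subsetP J'W); rewrite inE => /andP[_ /subsetP/(_ x xf)].
  by rewrite WP eqxx.
- have [->|zy] := eqVneq z y.
    suff /eqP -> : degree (R :\: J) y == 0 by [].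
    rewrite degree_eq0; apply/notin_coverP => f; rewrite in_setD in_symd => /andP[fJ fR].
    apply: contra fJ => yf; rewrite inE (subsetP RE _ fR) yf /=.
    apply/negP => /(subsetP J'W); rewrite inE => /andP[_ /subsetP/(_ y yf)].
    by rewrite WP eqxx andbF.
  have := congr1 odd (degreeD z JR); rewrite oddD dR dJ // WP MP zy /odd_or0 !andbT.
  case: (eqVneq z v) => [->|_] /=; first by rewrite eq_sym xv => /= /esym; case: (odd _).
  by case: (z == x) => /= /esym; case: (odd _).
Qed.

(* All degrees of [K :|: star v] are even, and it is connected up to isolated
   vertices, which leave an even number of vertices. *)
Lemma colorable_apex (G : sgraph) (v : G) (K : {set {set G}}) :
  odd #|G| -> evenv G = [set v] -> nbr v != set0 -> K \subset edges G -> v \notin cover K ->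
  oddv K = nbr v ->
  (forall D : {set {set G}}, D \subset K -> oddv D = set0 -> [disjoint cover D & nbr v] ->
    D = set0) ->
  odd #|[set x | x \notin v |: nbr v & x \notin cover K]| ->
  odd_chromatic_index G <= 3.
Proof.
move=> oG ev /set0Pn[a va] KE vK oK valid oI; rewrite inE in va.
set R := K :|: star v; have RE : R \subset edges G := apex_sub v KE.
have v_even : v \in evenv G by rewrite ev set11.
have evR x : ~~ odd (degree R x).
  have [->|xv] := eqVneq x v.
    by rewrite apex_degree_apex //; move: v_even; rewrite !inE.
  rewrite apex_degree // oddD degree_star //.
  by have /setP/(_ x) := oK; rewrite !inE => ->; case: (adj v x).
have coverR : cover R = ~: [set x | x \notin v |: nbr v & x \notin cover K].
  apply/setP => x; rewrite !in_set -!degree_eq0 -degree_gt0 apex_degree //.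
  have [->|xv] := eqVneq x v; last first.
    by rewrite degree_star // in_set1 (negPf xv); case: (adj v x); case: (degree K x).
  rewrite degree_star_id degree_edges addn_gt0 orbC set11.
  by have -> : 0 < #|nbr v| by apply/card_gt0P; exists a; rewrite inE.
have eW : ~~ odd #|cover R|.
  move: oG; rewrite -(cardsC [set x | x \notin v |: nbr v & x \notin cover K]).
  by rewrite -coverR oddD oI.
pose e := [rel a b | [set a; b] \in R].
have symR : connect_sym e by apply: sym_connect_sym => u w /=; rewrite setUC.
have reach x : x \in cover R -> connect e v x.
  move=> xR; apply/negPn/negP => nx.
  pose Z := [set z | connect e v z].
  have nZ : nbr v \subset Z.
    apply/subsetP => w; rewrite !inE => vw; apply: connect1.
    by rewrite /= inE [_ \in star _]inE mem_edges vw set21 orbT.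
  (* [D] is the part of [K] outside the component [Z] of [v]. Its degrees are 0 on [Z] and those of
     [K] elsewhere, and [K] is odd only on [nbr v], inside [Z]; so [D] is even and [valid] makes it
     empty. *)
  pose D := [set f in K | ~~ (f \subset Z)].
  have DK : D \subset K by apply/subsetP => f; rewrite inE => /andP[].
  have DZ f z : f \in D -> z \in f -> z \notin Z.
    move=> fD zf; have fK := subsetP DK _ fD.
    have [w zw fE] := edgeP (subsetP KE _ fK) zf.
    move: fD; rewrite inE => /andP[_]; apply: contra => zZ.
    rewrite fE subUset !sub1set zZ /=; move: zZ; rewrite !inE => vz.
    by apply: connect_trans vz (connect1 _); rewrite /= -fE inE fK.
  have D0 : D = set0.
    apply: valid => //.
      apply/setP => z; rewrite inE in_set0; apply/negbTE.
      have [zZ|zZ] := boolP (z \in Z).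
        suff /eqP -> : degree D z == 0 by [].
        by rewrite degree_eq0; apply/notin_coverP => f /DZ nfZ; apply: contraL zZ => /nfZ.
      have -> : degree D z = degree K z.
        apply: eq_degree => f zf; rewrite inE andbC.
        suff -> : ~~ (f \subset Z) by [].
        by apply: contra zZ => /subsetP; apply.
      have : z \notin oddv K by rewrite oK; apply: contra zZ; apply: (subsetP nZ).
      by rewrite inE.
    rewrite -setI_eq0 -subset0; apply/subsetP => z; rewrite inE => /andP[].
    by case/bigcupP => f /DZ zf /zf zZ /(subsetP nZ); rewrite (negPf zZ).
  have nZx : x \notin Z by rewrite inE.
  case/bigcupP: xR => f; rewrite inE => /orP[fK xf|].
    have := in_set0 f; rewrite -D0 inE fK /= => /negbFE/subsetP/(_ x xf).
    by rewrite (negPf nZx).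
  rewrite inE => /andP[fE vf] xf; have [w vw fvw] := edgeP fE vf.
  case/negP: nZx; move: xf; rewrite fvw => /set2P[]->.
    by rewrite inE connect0.
  by apply: (subsetP nZ); rewrite inE.
have [|J JR oJ] := @tjoin _ R (cover R) (cover R) RE _ (subxx _) eW.
  by move=> b c bR cR; apply: connect_trans (reach c cR); rewrite symR reach.
have dJ x : odd_or0 (degree J x) && odd_or0 (degree (R :\: J) x).
  have [xR|xR] := boolP (x \in cover R); last first.
    by rewrite !(degree_sub0 _ xR) // subsetDl.
  have := congr1 odd (degreeD x JR); rewrite (negPf (evR x)) oddD.
  have /setP/(_ x) := oJ; rewrite xR inE /odd_or0 => ->.
  by case: (odd _).
apply: (@colorable3 _ R J) => // x; try by case/andP: (dJ x).
apply: apex_rest => //; rewrite oK ev setDv; apply/setP => z.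
by rewrite in_symd in_set0 addbF.
Qed.

(** A minimal join of two distinct vertices is a path, encoded by its odd vertices and the absence
    of nonempty even subsets. *)
Lemma path_join (G : sgraph) (A : {set G}) (y p : G) : connected_in A ->
  y \in A -> p \in A -> y != p ->
  exists Q : {set {set G}}, [/\ Q \subset edges_in A, oddv Q = [set y; p] &
    forall D : {set {set G}}, D \subset Q -> oddv D = set0 -> D = set0].
Proof.
move=> cA yA pA yp.
have [||Q0 Q0A oQ0] := @tjoin_in _ A [set y; p] cA.
- by rewrite subUset !sub1set yA.
- by rewrite cards2 yp.
have [Q [QA oQ minQ]] := tjoin_min set0 Q0A.
exists Q; split=> // [|D DQ oD]; first by rewrite oQ.
apply/eqP; rewrite -subset0; apply: minQ => //; first exact: subset_trans QA.
by rewrite setU0.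
Qed.

(** The two sides share only [y], so [D :&: Q1] has even degree at every other vertex, and by the
    handshake lemma at [y] too. *)
Lemma evenfree_glue (G : sgraph) (y : G) (N1 N2 : {set G}) (Q1 Q2 D : {set {set G}}) :
  [disjoint N1 & N2] -> y \notin N1 :|: N2 ->
  Q1 \subset edges_in (y |: N1) -> Q2 \subset edges_in (y |: N2) ->
  (forall D : {set {set G}}, D \subset Q1 -> oddv D = set0 -> D = set0) ->
  D \subset Q1 :|: Q2 -> oddv D = set0 -> D :&: Q1 = set0.
Proof.
move=> dN yN Q1N Q2N free1 DQ oD; apply: free1; first exact: subsetIr.
have D1E : D :&: Q1 \subset edges G.
  by apply: subset_trans (subsetIr _ _) (subset_trans Q1N (edges_in_sub _)).
have eD x : ~~ odd (degree D x) by have /setP/(_ x) := oD; rewrite !inE => ->.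
have only_y x : x != y -> ~~ odd (degree (D :&: Q1) x).
  move=> xy; have [xN1|xN1] := boolP (x \in N1).
    rewrite (_ : degree _ x = degree D x) //; apply: eq_degree => f xf.
    rewrite inE; case: (boolP (f \in D)) => //= fD.
    have := subsetP DQ _ fD; rewrite inE => /orP[//|/(subsetP Q2N)].
    rewrite inE => /andP[_ /subsetP/(_ x xf)]; rewrite !inE (negPf xy) /=.
    by rewrite (disjointFr dN xN1).
  rewrite (@degree_sub0 _ _ Q1) ?subsetIr //; apply/negP => /(edges_in_cover Q1N).
  by rewrite !inE (negPf xy) (negPf xN1).
apply/setP => x; rewrite inE in_set0; apply/negbTE.
have [->|] := eqVneq x y; last exact: only_y.
apply/negP => oy; have := handshake D1E.
rewrite (_ : oddv _ = [set y]) ?cards1 //; apply/setP => z; rewrite !inE.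
by have [->|/only_y/negPf] := eqVneq z y.
Qed.

Lemma cover_symd (G : sgraph) (F C : {set {set G}}) x :
  x \notin cover C -> (x \in cover (symd F C)) = (x \in cover F).
Proof.
move=> xC; rewrite -!degree_gt0; congr (0 < _); apply: eq_degree => f xf.
rewrite in_symd; case: (boolP (f \in C)) => [fC|]; last by rewrite addbF.
by have /negP := notin_coverP _ _ xC f fC.
Qed.

(* Two cycles [C1], [C2] through [u] and [y], otherwise disjoint apart from the
   edge [u y], are added to a join [F] avoiding [u].  At a vertex other than [u]
   and [y] at most one of them changes anything, so it is isolated in an even
   number of [F], [F + C1], [F + C2], [F + C1 + C2], while [u] is isolated in [F]
   only: the four numbers of isolated vertices are not all even. *)
Lemma colorable_theta (G : sgraph) (v u y p r : G) (N1 N2 : {set G}) :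
  odd #|G| -> evenv G = [set v] -> connected_in (~: [set u; v]) ->
  u \notin v |: nbr v -> y \in nbr v -> adj u y -> adj u p -> adj u r ->
  N1 \subset ~: [set u; v] -> N2 \subset ~: [set u; v] -> [disjoint N1 & N2] ->
  y \notin N1 :|: N2 -> p \in N1 -> r \in N2 ->
  connected_in (y |: N1) -> connected_in (y |: N2) ->
  odd_chromatic_index G <= 3.
Proof.
move=> oG ev cJ uv vy uy up ur N1J N2J dN yN pN1 rN2 c1 c2.
have v_even : v \in evenv G by rewrite ev set11.
have yp : y != p by apply: contra yN => /eqP ->; rewrite inE pN1.
have yr : y != r by apply: contra yN => /eqP ->; rewrite inE rN2 orbT.
have pr : p != r by apply/eqP => e; have := disjointFr dN pN1; rewrite e rN2.
have yJ : y \in ~: [set u; v].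
  rewrite !inE negb_or eq_sym (adj_neq uy) eq_sym adj_neq //.
  by rewrite inE in vy.
have nJ : nbr v \subset ~: [set u; v].
  apply/subsetP => x; rewrite !inE => vx; rewrite negb_or (eq_sym x v) (adj_neq vx) andbT.
  by apply: contra uv => /eqP <-; rewrite !inE vx orbT.
have [Q1 [Q1N oQ1 free1]] := path_join c1 (setU11 y N1) (setU1r y pN1) yp.
have [Q2 [Q2N oQ2 free2]] := path_join c2 (setU11 y N2) (setU1r y rN2) yr.
have Q1J : Q1 \subset edges_in (~: [set u; v]).
  by apply: subset_trans Q1N (edges_inS _); rewrite subUset sub1set yJ.
have Q2J : Q2 \subset edges_in (~: [set u; v]).
  by apply: subset_trans Q2N (edges_inS _); rewrite subUset sub1set yJ.
have [F0 F0J oF0] := tjoin_in cJ nJ (nbr_even v_even).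
(* Minimality modulo [Q1 :|: Q2] confines the even subsets of [F :|: (Q1 :|: Q2)] to the two paths,
   which share only [y]; hence [freeQ]. *)
have [F [FJ oF minF]] := tjoin_min (Q1 :|: Q2) F0J; rewrite oF0 in oF.
have freeQ (D : {set {set G}}) : D \subset F :|: (Q1 :|: Q2) -> oddv D = set0 -> D = set0.
  move=> DFQ oD; have DJ : D \subset edges_in (~: [set u; v]).
    by apply: subset_trans DFQ _; rewrite !subUset FJ Q1J.
  have DQ := minF D DJ DFQ oD; rewrite -(setIidPl DQ) setIUr.
  rewrite (evenfree_glue dN yN Q1N Q2N free1 DQ oD) set0U.
  rewrite setUC in DQ; rewrite setUC in yN; rewrite disjoint_sym in dN.
  exact: (evenfree_glue dN yN Q2N Q1N free2 DQ oD).
have JE (f : {set G}) x : f \in edges_in (~: [set u; v]) -> x \in [set u; v] -> x \notin f.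
  rewrite inE => /andP[_ /subsetP fJ] xuv; apply/negP => /fJ.
  by rewrite inE xuv.
(* The path [Q1] is closed to a cycle by the edges from [u] to [p] and [y]; likewise [Q2] with
   [r]. *)
pose C1 := symd Q1 (symd [set [set u; p]] [set [set u; y]]).
pose C2 := symd Q2 (symd [set [set u; r]] [set [set u; y]]).
have oC (Q : {set {set G}}) q : adj u q -> y != q -> oddv Q = [set y; q] ->
    oddv (symd Q (symd [set [set u; q]] [set [set u; y]])) = set0.
  move=> uq yq oQ; rewrite !oddv_symd !oddv_single // oQ; apply/setP => z.
  rewrite !in_symd !inE; have [->|zu] := eqVneq z u.
    by rewrite (negPf (adj_neq uq)) (negPf (adj_neq uy)).
  by have [->|] := eqVneq z y; [rewrite (negPf yq)|case: (z == q)].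
have oC1 : oddv C1 = set0 := oC _ _ up yp oQ1.
have oC2 : oddv C2 = set0 := oC _ _ ur yr oQ2.
have uJ (f : {set G}) : u \in f -> f \in edges_in (~: [set u; v]) = false.
  by move=> uf; apply/negP => /JE/(_ (set21 u v)); rewrite uf.
have uF (f : {set G}) : u \in f -> [/\ f \in F = false, f \in Q1 = false & f \in Q2 = false].
  move=> /uJ fJ; split; apply/negP => fF; move/negP: fJ; apply.
  - exact: (subsetP FJ).
  - exact: (subsetP Q1J).
  - exact: (subsetP Q2J).
have inj_u a b : ([set u; a] == [set u; b]) = (a == b).
  by apply/eqP/eqP => [/set2_inj|->].
have C1u a : ([set u; a] \in C1) = (a == p) (+) (a == y).
  by rewrite /C1 in_symd; case: (uF _ (set21 u a)) => _ -> _; rewrite in_symd !inE !inj_u.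
have C2u a : ([set u; a] \in C2) = (a == r) (+) (a == y).
  by rewrite /C2 in_symd; case: (uF _ (set21 u a)) => _ _ ->; rewrite in_symd !inE !inj_u.
pose U := F :|: (Q1 :|: Q2) :|: (star u).
have CU (Q : {set {set G}}) q : adj u q -> Q \subset F :|: (Q1 :|: Q2) ->
    symd Q (symd [set [set u; q]] [set [set u; y]]) \subset U.
  move=> uq QF; apply: subset_symd; first exact: subset_trans (subsetUl _ _).
  apply: subset_trans (subsetUr _ _); apply: subset_symd; rewrite sub1set inE mem_edges set21.
    by rewrite uq.
  by rewrite uy.
have C1U : C1 \subset U by apply: CU => //; rewrite setUCA subsetUl.
have C2U : C2 \subset U by apply: CU => //; rewrite setUA subsetUr.
have FU : F \subset U by rewrite /U -setUA subsetUl.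
have covC1 x : x != u -> x \in cover C1 -> x \in y |: N1.
  move=> xu /bigcupP[f]; rewrite /C1 in_symd; case: (boolP (f \in Q1)) => [fQ _ xf|_ /=].
    by apply: (edges_in_cover Q1N); apply/bigcupP; exists f.
  rewrite in_symd !inE; have [-> _|_ /= /eqP ->] := eqVneq f [set u; p].
    by rewrite !inE (negPf xu) /= => /eqP ->; rewrite pN1 orbT.
  by rewrite !inE (negPf xu) /= => ->.
have covC2 x : x != u -> x \in cover C2 -> x \in y |: N2.
  move=> xu /bigcupP[f]; rewrite /C2 in_symd; case: (boolP (f \in Q2)) => [fQ _ xf|_ /=].
    by apply: (edges_in_cover Q2N); apply/bigcupP; exists f.
  rewrite in_symd !inE; have [-> _|_ /= /eqP ->] := eqVneq f [set u; r].
    by rewrite !inE (negPf xu) /= => /eqP ->; rewrite rN2 orbT.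
  by rewrite !inE (negPf xu) /= => ->.
pose iso (K : {set {set G}}) := [set x | x \notin v |: nbr v & x \notin cover K].
suff main (K : {set {set G}}) : K \subset U -> oddv K = nbr v -> (forall a, [set u; a] \in K -> a \in [set p; r; y]) ->
    odd #|iso K| -> odd_chromatic_index G <= 3.
  have symd0 (S : {set G}) : symd S set0 = S.
    by apply/setP => z; rewrite in_symd in_set0 addbF.
  have Fu a : ([set u; a] \in F) = false by case: (uF _ (set21 u a)).
  have [o|o0] := boolP (odd #|iso F|).
    by apply: (main F) => // a; rewrite Fu.
  have [o|o1] := boolP (odd #|iso (symd F C1)|).
    apply: (main (symd F C1)) => //; [exact: subset_symd | by rewrite oddv_symd oC1 symd0 |].
    by move=> a; rewrite in_symd Fu C1u !inE; case: (a == p); rewrite //= => ->; rewrite orbT.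
  have [o|o2] := boolP (odd #|iso (symd F C2)|).
    apply: (main (symd F C2)) => //; [exact: subset_symd | by rewrite oddv_symd oC2 symd0 |].
    by move=> a; rewrite in_symd Fu C2u !inE; case: (a == r); rewrite //= ?orbT // => ->; rewrite orbT.
  apply: (main (symd (symd F C1) C2)).
  - by apply: subset_symd => //; apply: subset_symd.
  - by rewrite (oddv_symd (symd F C1)) (oddv_symd F) oC1 oC2 !symd0.
  - move=> a; rewrite 2!in_symd Fu C1u C2u !inE.
    by case: (a == p); case: (a == r); case: (a == y).
  have isoE : symd (symd (iso F) (iso (symd F C1)))
                   (symd (iso (symd F C2)) (iso (symd (symd F C1) C2))) = [set u].
    apply/setP => x; rewrite !in_symd ![_ \in iso _]inE in_set1.
    have [->|xu] := eqVneq x u.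
      rewrite uv /=.
      have -> : u \in cover F = false.
        by apply/negbTE/notin_coverP => f fF; apply/negP => /uF[]; rewrite fF.
      have cov a (K : {set {set G}}) : [set u; a] \in K -> u \in cover K.
        by move=> aK; apply/bigcupP; exists [set u; a]; rewrite ?set21.
      have -> : u \in cover (symd F C1).
        by apply: (cov p); rewrite in_symd Fu C1u eqxx eq_sym (negPf yp).
      have -> : u \in cover (symd F C2).
        by apply: (cov r); rewrite in_symd Fu C2u eqxx eq_sym (negPf yr).
      suff -> : u \in cover (symd (symd F C1) C2) by [].
      apply: (cov p); rewrite 2!in_symd Fu C1u C2u eqxx (negPf pr).
      by rewrite eq_sym (negPf yp).
    have [//|xO] := boolP (x \in v |: nbr v); rewrite /=.
    have xy : x != y by apply: contra xO => /eqP ->; rewrite inE vy orbT.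
    have [x1|x1] := boolP (x \in cover C1); last first.
      rewrite (cover_symd _ x1).
      have -> : (x \in cover (symd (symd F C1) C2)) = (x \in cover (symd F C2)).
        rewrite -(cover_symd (symd F C2) x1); by rewrite symdAC.
      by rewrite !addbb.
    have x2 : x \notin cover C2.
      apply/negP => /(covC2 x xu); have := covC1 x xu x1.
      by rewrite !inE (negPf xy) /= => /(disjointFr dN) ->.
    by rewrite !(cover_symd _ x2); case: (x \in cover F); case: (x \in cover _).
  have := congr1 (fun S : {set G} => odd #|S|) isoE.
  by rewrite /= !odd_card_symd cards1 (negPf o0) (negPf o1) (negPf o2).
move=> KU oK Ku oI.
have UE : U \subset edges G.
  by rewrite !subUset star_sub !(subset_trans _ (edges_in_sub (~: [set u; v]))).
have KE := subset_trans KU UE.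
have uvn : u != v by apply: contra uv => /eqP ->; rewrite setU11.
have vK : v \notin cover K.
  apply/notin_coverP => f /(subsetP KU); rewrite inE => /orP[fFQ|].
    apply: (@JE f v); last exact: set22.
    move: fFQ; rewrite !in_setU => /or3P[/(subsetP FJ)|/(subsetP Q1J)|/(subsetP Q2J)] //.
  rewrite inE => /andP[fE uf]; have [w uw ->] := edgeP fE uf.
  rewrite !inE negb_or eq_sym uvn /=; apply: contra uv => /eqP ->.
  by rewrite !inE adj_sym uw orbT.
apply: (@colorable_apex _ v K) => //; first by apply/set0Pn; exists y.
(* [D] misses [y], hence the edge from [u] to [y]; being even at [u], it has both edges from [u] to
   [p] and [r] or neither. In the latter case it lies in [F :|: (Q1 :|: Q2)], and [freeQ] makes it
   empty. *)
move=> D DK oD dD; apply/eqP/negPn/negP => D0.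
have yD : y \notin cover D by apply/negP => yD; have := disjointFr dD yD; rewrite vy.
have uyD : [set u; y] \notin D.
  by apply/negP => h; case/negP: yD; apply/bigcupP; exists [set u; y]; rewrite ?set22.
have DU := subset_trans DK KU.
have Dua a : [set u; a] \in D -> a = p \/ a = r.
  move=> aD; have := Ku a (subsetP DK _ aD); rewrite !inE -orbA => /or3P[]/eqP e; auto.
  by case/negP: uyD; rewrite -e.
have edge_u (f : {set G}) : f \in U -> u \in f -> exists2 a, adj u a & f = [set u; a].
  by move=> fU; apply: edgeP (subsetP UE _ fU).
have inFQ (S : {set {set G}}) : S \subset U -> (forall a, [set u; a] \notin S) ->
    S \subset F :|: (Q1 :|: Q2).
  move=> SU Sa; apply/subsetP => f fS; have fU := subsetP SU _ fS.
  move: (fU); rewrite inE => /orP[//|]; rewrite inE => /andP[_ uf].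
  have [a _ fE] := edge_u f fU uf.
  by have := Sa a; rewrite -fE fS.
have upr : ([set u; p] \in D) = ([set u; r] \in D).
  have : ~~ odd (degree D u) by have /setP/(_ u) := oD; rewrite !inE => ->.
  have -> : degree D u = ([set u; p] \in D) + ([set u; r] \in D).
    rewrite /degree (cardsD1 [set u; p]) (cardsD1 [set u; r]) !inE eqxx /= !andbT.
    rewrite inj_u eq_sym pr /= addnA; apply/eqP.
    rewrite -[X in _ == X]addn0 eqn_add2l cards_eq0 -subset0.
    apply/subsetP => f; rewrite !inE => /and4P[fr fp fD uf].
    have [a _ fE] := edge_u f (subsetP DU _ fD) uf.
    by move: fD fr fp; rewrite fE => /Dua[]->; rewrite eqxx.
  by case: (_ \in D); case: (_ \in D).
have [upD|upD] := boolP ([set u; p] \in D); last first.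
  case/negP: D0; apply/eqP; apply: freeQ oD; apply: inFQ => // a.
  by apply/negP => aD; have := aD; case: (Dua a aD) => ->; rewrite -?upr (negPf upD).
(* The edge from [u] to [y] cancels in the sum of [C1] and [C2], so adding this sum to [D] removes
   all edges at [u]. By [freeQ] the two are equal; but the sum has an edge of [Q1] at [y]. *)
have DC : symd D (symd C1 C2) = set0.
  apply: freeQ; last first.
    rewrite (oddv_symd D) (oddv_symd C1) oC1 oC2 oD.
    by apply/setP => z; rewrite !in_symd !in_set0.
  apply: inFQ; first by do 2!apply: subset_symd => //.
  move=> a; rewrite 2!in_symd C1u C2u.
  have [->|ap] := eqVneq a p; first by rewrite upD (negPf pr); case: (p == y).
  have [->|ar] := eqVneq a r; first by rewrite -upr upD; case: (r == y).
  rewrite !addFb addbb addbF; apply/negP => /Dua[] e.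
    by rewrite e eqxx in ap.
  by rewrite e eqxx in ar.
have : y \in cover Q1 by apply: oddv_sub_cover; rewrite oQ1 set21.
case/bigcupP => f fQ1 yf.
have fD : f \notin D by apply: contraL yf; apply: notin_coverP.
have fE : f \in edges G by apply: (subsetP (subset_trans Q1N (edges_in_sub _))).
have uf : u \notin f by apply: (JE f u); [exact: (subsetP Q1J) | exact: set21].
have fu a : f == [set u; a] = false by apply: contraNF uf => /eqP ->; rewrite set21.
have fQ2 : f \notin Q2.
  have [w yw fw] := edgeP fE yf; apply/negP => fQ2.
  have w1 := edges_in_cover Q1N (x := w); have w2 := edges_in_cover Q2N (x := w).
  have wf : w \in f by rewrite fw set22.
  have wy : w != y by rewrite eq_sym adj_neq.
  have : w \in cover Q1 by apply/bigcupP; exists f.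
  have : w \in cover Q2 by apply/bigcupP; exists f.
  by move=> /w2 + /w1; rewrite !inE (negPf wy) /= => wN2 /(disjointFr dN); rewrite wN2.
have fC (Q : {set {set G}}) q :
    (f \in symd Q (symd [set [set u; q]] [set [set u; y]])) = (f \in Q).
  by rewrite !in_symd !in_set1 !fu !addbF.
have := in_set0 f; rewrite -DC 2!in_symd (fC Q1 p) (fC Q2 r) fQ1 (negPf fQ2).
by rewrite (negPf fD).
Qed.

(** * From 4-connectivity to the colourings *)

(** Deleting fewer than [k] neighbours would isolate [x], and other vertices remain because there
    are more than [k] in all. *)
Lemma min_degree (G : sgraph) (k : nat) (x : G) : k_connected k G -> k <= #|nbr x|.
Proof.
move=> /andP[ltk /forallP kc]; rewrite leqNgt; apply/negP => small.
have cS : connected_in (~: nbr x) := implyP (kc (nbr x)) small.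
have xS : x \in ~: nbr x by rewrite !inE adj_irr.
have [|||u [w []]] := @connected_cut _ _ [set x] cS; first by rewrite sub1set.
- by apply/set0Pn; exists x; rewrite inE.
- apply/eqP => e; have := cardsC (nbr x); rewrite -e cards1 addn1 => cG.
  by move: ltk; rewrite -cG ltnS leqNgt small.
by move=> /set1P -> wS _ xw; move: wS; rewrite !inE xw.
Qed.

Theorem theorem1p5 (G : sgraph) (hconn : k_connected 4 G)
    (hodd : odd #|G|) : odd_chromatic_index G <= 3.
Proof.
have conn (S : {set G}) : #|S| < 4 -> connected_in (~: S).
  by move=> S4; have /andP[_ /forallP/(_ S)/implyP] := hconn; apply.
have biconn (S : {set G}) : #|S| < 3 -> biconnected (~: S).
  move=> S3; split=> [|x]; first by apply: conn; apply: ltnW.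
  rewrite (_ : _ :\ x = ~: (x |: S)); last by apply/setP => z; rewrite !inE negb_or.
  by apply: conn; rewrite cardsU1; case: (_ \in _) => //=; apply: ltnW.
have oE := evenv_odd hodd.
have [v v_even] : exists v, v \in evenv G.
  by apply/set0Pn; apply: contraTneq oE => ->; rewrite cards0.
have nbr4 x : 4 <= #|nbr x| := min_degree x hconn.
have nv : nbr v \subset ~: [set v].
  by apply/subsetP => x; rewrite !inE eq_sym => /adj_neq.
have [E1|E1] := leqP #|evenv G| 1; last first.
  have [|||||C [K [[cC cK] dCK CK A1 B1]]] := @split_one_one _ (~: [set v]) (nbr v) (evenv G :\ v).
  - by apply: biconn; rewrite cards1.
  - exact: nv.
  - by apply/subsetP => x; rewrite !inE => /andP[].
  - by rewrite -card_gt0; apply: leq_trans (nbr4 v).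
  (* The number of vertices of even degree is odd and above 1, so at least two remain besides
     [v]. *)
  - by move: oE E1; rewrite (cardsD1 v) v_even; case: #|_| => [|[|]].
  by apply: (@colorable_split _ v C K); rewrite ?A1 ?B1.
have ev : evenv G = [set v].
  by apply/eqP; rewrite eq_sym eqEcard sub1set v_even cards1.
have [univ|] := boolP [forall u, (u == v) || adj v u].
  have univP w : w != v -> adj v w by have /forallP/(_ w)/orP[->|] := univ.
  have [x vx] : exists x, x \in nbr v by apply/card_gt0P; apply: leq_trans (nbr4 v).
  have xv : x != v by have := subsetP nv _ vx; rewrite !inE.
  have ox : odd #|nbr x|.
    have /setP/(_ x) := ev; rewrite !inE (negPf xv) degree_edges => /negbT.
    by rewrite negbK.
  (* [x] has odd degree, but the number of other vertices is even. *)
  have [y] : exists y, y \notin x |: nbr x.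
    apply/existsP; rewrite -negb_forall; apply/negP => /forallP all_x.
    have xT : x |: nbr x = setT by apply/setP => z; rewrite all_x inE.
    have := cardsT G; rewrite -xT cardsU1 inE adj_irr /= => cG.
    by move: hodd; rewrite -cG /= ox.
  rewrite !inE negb_or eq_sym => /andP[xy nxy].
  have yv : y != v by apply: contra nxy => /eqP ->; rewrite adj_sym univP.
  apply: (@colorable_universal _ v x y) => //; apply: conn.
  by rewrite -setUA cardsU1 cards2; case: (_ \notin _); case: (_ != _).
rewrite negb_forall => /existsP[w]; rewrite negb_or => /andP[wv nvw].
have cT : connected_in [set: G] by rewrite -setC0; apply: conn; rewrite cards0.
(* An edge leaves the closed neighbourhood of [v]; its inner end [y] is not [v], because its outer
   end [u] is not adjacent to [v]. *)
have [|||y [u [yD _ uD yu]]] := @connected_cut _ _ (v |: nbr v) cT; first exact: subsetT.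
- by apply/set0Pn; exists v; rewrite setU11.
- by apply/eqP => /setP/(_ w); rewrite !inE (negPf wv) (negPf nvw).
have vy : y \in nbr v.
  move: yD; rewrite in_setU1 => /orP[/eqP yv|//].
  by move: uD; rewrite -yv !inE yu orbT.
have uy : adj u y by rewrite adj_sym.
have [p [r [pS rS pr]]] : exists p r, [/\ p \in nbr u :\ y, r \in nbr u :\ y & p != r].
  apply/card_gt1P; have := nbr4 u; rewrite (cardsD1 y) inE uy.
  by rewrite add1n ltnS => /ltnW.
have uN z : adj u z -> z \in ~: [set u; v].
  move=> uz; rewrite !inE negb_or eq_sym (adj_neq uz) /=.
  by apply: contra uD => /eqP zv; rewrite !inE -zv adj_sym uz orbT.
move: pS rS; rewrite !inE => /andP[py up] /andP[ry ur].
have uv2 : #|[set u; v]| < 3 by rewrite cards2; case: (_ != _).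
(* The fan in [G] minus [u] and [v] provides the two sides of the theta graph, entered from [u]
   through [p] and [r]. *)
have [N1 [N2 [[N1J N2J dN] yN pN rN [c1 c2]]]] :=
  fan (biconn _ uv2) (uN p up) (uN r ur) (uN y uy) pr py ry.
apply: (@colorable_theta _ v u y p r N1 N2) => //.
by case: (biconn _ uv2).
Qed.
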